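(* Let $\mu=(\mu_1,\ldots,\mu_n)\in\mathbb{Z}_{\ge 0}^n$, and suppose $n=\sum_{i=1}^n i\mu_i$; set $k=\sum_{i=1}^n\mu_i$. Let $\mathcal{A}_\mu$ be the set of dissections of the polygon $P_{n+2}$ whose subgons consist of exactly $\mu_i$ subgons with $i+2$ vertices for each $1\le i\le n$ (such dissections use $k-1$ diagonals), let $G_{n+2}=\langle\sigma\rangle$ be the cyclic group of order $n+2$ acting on $\mathcal{A}_\mu$ by rotation, and let $$a_\mu(q)=\frac{1}{[n+1]_q}\begin{bmatrix} n+k\\ k\end{bmatrix}_q\begin{bmatrix} k\\ \mu_1,\mu_2,\ldots,\mu_n\end{bmatrix}_q .$$ Then the triple $(\mathcal{A}_\mu,G_{n+2},a_\mu(q))$ exhibits the cyclic sieving phenomenon.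
   Context: $P_N$ denotes a convex polygon with vertices $v_0,\ldots,v_{N-1}$ in clockwise order, indices taken modulo $N$. A dissection of $P_N$ is a set of pairwise non-crossing diagonals; its subgons are the connected components of $P_N$ minus the diagonals. The rotation $\sigma$ sends $v_i\mapsto v_{i-1}$ for all $i$, and acts on dissections by sending each diagonal $(v_i,v_j)$ to $(v_{i-1},v_{j-1})$. $q$-notation: $[a]_q=1+q+\cdots+q^{a-1}$, $[a]_q!=[1]_q\cdots[a]_q$, $\begin{bmatrix} a\\ b\end{bmatrix}_q=\frac{[a]_q!}{[b]_q![a-b]_q!}$, and $\begin{bmatrix} k\\ \mu_1,\ldots,\mu_n\end{bmatrix}_q=\frac{[k]_q!}{[\mu_1]_q!\cdots[\mu_n]_q!}$. A triple $(X,G,X(q))$ consisting of a finite set $X$ with an action of a cyclic group $G=\langle\sigma\rangle$ of order $N$ and a polynomial $X(q)\in\mathbb{Z}[q]$ exhibits the cyclic sieving phenomenon if for every integer $j$, $X(\zeta_N^j)$ equals the number of elements of $X$ fixed by $\sigma^j$, where $\zeta_N$ is a primitive $N$-th root of unity. *)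

(* Defs.v *)
From mathcomp Require Import all_boot all_order all_algebra all_field.
Set Implicit Arguments. Unset Strict Implicit. Unset Printing Implicit Defensive.
Import GRing.Theory Num.Theory.

(* Polygon P_N: vertices v_0..v_{N-1} are the elements of 'I_N, in clockwise
   order; ordS is the clockwise successor, ord_pred the predecessor. *)
Section Polygon.
Variable N : nat.

Definition arc_between (a b z : 'I_N) : bool :=
  (0 < (z + N - a) %% N) && ((z + N - a) %% N < (b + N - a) %% N).

Definition is_side (a b : 'I_N) : bool := (b == ordS a) || (a == ordS b).

Definition is_diagonal (e : {set 'I_N}) : bool :=
  [exists a, exists b, [&& e == [set a; b], a != b & ~~ is_side a b]].

Definition separates (e : {set 'I_N}) (z w : 'I_N) : bool :=
  [exists a, exists b, [&& e == [set a; b], arc_between a b z & arc_between b a w]].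

Definition crossing (e f : {set 'I_N}) : bool :=
  [exists c, exists d, (f == [set c; d]) && separates e c d].

Definition dissection (D : {set {set 'I_N}}) : bool :=
  [forall e in D, is_diagonal e] && [forall e in D, forall f in D, ~~ crossing e f].

Definition consec (S : {set 'I_N}) (x y : 'I_N) : bool :=
  [&& x \in S, y \in S, x != y & [forall z in S, ~~ arc_between x y z]].

(* Combinatorial description of the subgons (faces) of a dissection D, given by
   their vertex sets S: a convex polygon with >= 3 vertices whose boundary
   edges are sides of P_N or diagonals of D, and which no diagonal of D cuts. *)
Definition subgon (D : {set {set 'I_N}}) (S : {set 'I_N}) : bool :=
  [&& 3 <= #|S|,
      [forall x, forall y, consec S x y ==> (is_side x y || ([set x; y] \in D))]
    & [forall e in D, forall z in S, forall w in S, ~~ separates e z w]].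

Definition subgons (D : {set {set 'I_N}}) : {set {set 'I_N}} :=
  [set S | subgon D S].

Definition rot_dissection (D : {set {set 'I_N}}) : {set {set 'I_N}} :=
  [set [set @ord_pred N x | x in e] | e : {set 'I_N} in D].

End Polygon.

Definition A_mu (n : nat) (mu : nat -> nat) : {set {set {set 'I_n.+2}}} :=
  [set D | dissection D &&
     [forall i : 'I_n.+1, (0 < i) ==>
        (#|[set S in subgons D | #|S| == i.+2]| == mu i)]].

Definition qint (a : nat) : {poly int} := \sum_(i < a) 'X^i.
Definition qfact (a : nat) : {poly int} := \prod_(i < a) qint i.+1.

(* Main.v *)
Require Import Defs.
From mathcomp Require Import all_boot all_order all_algebra all_field.
From mathcomp Require Import zify ring.
Import Order.TTheory GRing.Theory Num.Theory.
Set Implicit Arguments. Unset Strict Implicit. Unset Printing Implicit Defensive.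

(* Put N = n + 2.  Let [D] be a dissection invariant under a rotation of order d,
   say by m = N / d steps, and let [S] be an invariant face of [D], or an
   invariant diagonal seen as a two-vertex face.  Every other face has one edge
   facing [S]; orient that edge as an arc from [a] to [b] bounding the side away
   from [S], and write the number of vertices of the face other than [a] and [b]
   at the vertex [a], outer faces first.  Reading off these words around the
   polygon is a bijection from pairs [(D, S)] onto m-periodic sequences of words:
   in the lattice path that goes up at each vertex and down by each letter, the
   arc of a letter ends at the first return to the height before that letter.
   If nu i is the number of letters i per period and K is the sum of the nu i,
   there are (m - 1 + K)! / ((m - 1)! prod_i (nu i)!) such sequences.  For d = 1
   each [D] is counted mu i times when [S] is required to have i + 2 vertices;
   for d >= 2 each invariant [D] has exactly one invariant [S].  On the algebraic
   side the quotient of q-factorials vanishes at a primitive d-th root of unity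
   unless at most one mu i is not divisible by d, and otherwise has the same
   value. *)

(** * Chords and faces in integer coordinates *)

(** Encoding a dissection by a tree rooted at a side does not commute with rotation. Marking [S]
    restores equivariance: once all diagonals are directed away from [S], the arcs nest and the
    words depend on [(D, S)] alone. For [d >= 2] the mark comes for free, since only the face or
    diameter at the centre of the polygon can be preserved by a nontrivial rotation; for [d = 1] it
    is chosen by hand and divided out. A periodic sequence of words is an arrangement of its [K]
    letters and [m - 1] separators, whence the multinomial. The size of [S] need not be recorded
    separately: its vertices are the strict records of the lattice path, so there are as many as the
    net climb over one turn, which is [n + 2] minus the sum of the letters of that turn. Both sides
    of the identity see the same condition: a non-zero value and an invariant core each force the
    remainders of the [mu i] modulo [d] to have at most a single 1. A core of size two forces
    [d = 2]. *)

Section Lift.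
Variable n : nat.
Local Notation N := n.+2.
Implicit Types (a b c d x y z w : nat) (D : {set {set 'I_N}}) (S : {set 'I_N}).

Definition vtx z : 'I_N := inZp z.
(* [dl] stands for a lifted diagonal. *)
Definition dl D a b := [set vtx a; vtx b] \in D.

Lemma vtx_val (i : 'I_N) : vtx i = i.
Proof. exact: valZpK. Qed.

Lemma vtx_mod z w : (vtx z == vtx w) = (z == w %[mod N]).
Proof. by rewrite -val_eqE. Qed.

Lemma vtxD z k : vtx (z + k * N) = vtx z.
Proof. by apply/eqP; rewrite vtx_mod addnC modnMDl. Qed.

Lemma vtxDN z : vtx (z + N) = vtx z.
Proof. by have := vtxD z 1; rewrite mul1n. Qed.

Lemma vtx_inj a z w : a <= z < a + N -> a <= w < a + N -> vtx z = vtx w -> z = w.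
Proof.
wlog le_zw : z w / z <= w => [IH|].
  by case: (leqP z w) => [/IH//|/ltnW/IH IH' hz hw /esym/(IH' hw hz)].
move=> hz hw /eqP; rewrite vtx_mod eq_sym (eqn_mod_dvd N le_zw).
by case: (posnP (w - z)) => [|h /(dvdn_leq h)]; lia.
Qed.

Lemma vtx_congr x x' t : vtx x = vtx x' -> vtx (x + t) = vtx (x' + t).
Proof.
move/eqP; rewrite vtx_mod => E; apply/eqP.
by rewrite vtx_mod -modnDml (eqP E) modnDml.
Qed.

Lemma vtx_lift a (i : 'I_N) : exists2 z, a <= z < a + N & vtx z = i.
Proof.
exists (a + (i + N - a %% N) %% N).
  by have := ltn_pmod (i + N - a %% N) (isT : 0 < N); lia.
have lt_r := ltn_pmod a (isT : 0 < N).
rewrite -[RHS]vtx_val; apply/eqP; rewrite vtx_mod modnDmr.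
have -> : a + (i + N - a %% N) = (a %/ N).+1 * N + i.
  by have := divn_eq a N; have := ltn_ord i; lia.
by rewrite modnMDl.
Qed.

(** [arc_between] compares clockwise distances from [a]; in the window of [N] positions starting at
    [a] these are plain differences, so cyclic conditions become linear ones. *)
Lemma vtx_offset a z : a <= z < a + N -> (vtx z + N - vtx a) %% N = z - a.
Proof.
move=> /andP [az za]; rewrite /=.
have -> : z %% N = (a %% N + (z - a)) %% N by rewrite modnDml subnKC.
set r := a %% N; have lt_r : r < N by exact: ltn_pmod.
set k := z - a; have lt_k : k < N by lia.
case: (ltnP (r + k) N) => h.
  rewrite (modn_small h).
  have -> : r + k + N - r = k + N by lia.
  by rewrite modnDr modn_small.
have -> : (r + k) %% N = r + k - N.
  rewrite -{1}(subnK h) modnDr modn_small //; lia.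
have -> : r + k - N + N - r = k by lia.
by rewrite modn_small.
Qed.

Lemma arc_between_vtx a b z : a <= b < a + N -> a <= z < a + N ->
  arc_between (vtx a) (vtx b) (vtx z) = (a < z < b).
Proof. by move=> hb hz; rewrite /arc_between !vtx_offset //; lia. Qed.

Lemma ordS_vtx a : ordS (vtx a) = vtx a.+1.
Proof. by apply/val_inj; rewrite /= -addn1 modnDml addn1. Qed.

Lemma is_side_vtx a b : a < b < a + N ->
  is_side (vtx a) (vtx b) = (b == a.+1) || (b.+1 == a + N).
Proof.
move=> hb; rewrite /is_side !ordS_vtx; congr (_ || _).
  apply/eqP/eqP => [|->//]; apply: (@vtx_inj a); lia.
rewrite -(vtxDN a); apply/eqP/eqP => [|->//].
move/(@vtx_inj a.+1) => h; apply/esym/h; lia.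
Qed.

Lemma set2_eq (T : finType) (x y z w : T) : [set x; y] = [set z; w] ->
  x = z /\ y = w \/ x = w /\ y = z.
Proof.
move=> E.
have hx : x \in [set z; w] by rewrite -E !inE eqxx.
have hy : y \in [set z; w] by rewrite -E !inE eqxx orbT.
have hz : z \in [set x; y] by rewrite E !inE eqxx.
have hw : w \in [set x; y] by rewrite E !inE eqxx orbT.
move: hx hy hz hw; rewrite !inE.
by move=> /orP[]/eqP ? /orP[]/eqP ? /orP[]/eqP ? /orP[]/eqP ?; subst; auto.
Qed.

Lemma separates_vtx a b z w :
  a < b < a + N -> a <= z < a + N -> a <= w < a + N ->
  separates [set vtx a; vtx b] (vtx z) (vtx w) =
  (a < z < b) && (b < w) || (a < w < b) && (b < z).
Proof.
move=> hb hz hw.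
have arc_ab z' : a <= z' < a + N -> arc_between (vtx a) (vtx b) (vtx z') = (a < z' < b).
  by move=> h; apply: arc_between_vtx => //; lia.
have arc_ba z' : a <= z' < a + N -> arc_between (vtx b) (vtx a) (vtx z') = (b < z').
  move=> h; rewrite -(vtxDN a).
  case: (leqP b z') => h'; first by rewrite arc_between_vtx; lia.
  by rewrite -(vtxDN z') arc_between_vtx; lia.
rewrite /separates; apply/existsP/orP => [[x /existsP [y /and3P [/eqP/set2_eq E]]]|].
  case: E => [[<- <-]|[<- <-]]; rewrite ?arc_ab ?arc_ba // => -> ->; auto.
by case=> /andP [h1 h2]; [exists (vtx a) | exists (vtx b)]; apply/existsP;
  [exists (vtx b) | exists (vtx a)]; rewrite ?arc_ab ?arc_ba // h1 h2 ?eqxx // setUC eqxx.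
Qed.

Lemma is_diagonalP (e : {set 'I_N}) :
  reflect (exists a b, a.+2 <= b <= a + n /\ e = [set vtx a; vtx b]) (is_diagonal e).
Proof.
apply: (iffP existsP) => [[x /existsP [y /and3P [/eqP -> nxy nside]]]|[a [b [h ->]]]].
  have [b hb Eb] := vtx_lift x y.
  exists x, b; rewrite vtx_val Eb; split=> //.
  have nb : b <> x by move=> E; move: nxy; rewrite -Eb E vtx_val eqxx.
  move: nside; rewrite -Eb -{1}(vtx_val x) is_side_vtx; lia.
exists (vtx a); apply/existsP; exists (vtx b); rewrite eqxx is_side_vtx; last by lia.
apply/andP; split=> //; apply/andP; split; last by lia.
by apply/eqP => /(@vtx_inj a) h'; lia.
Qed.

Lemma dlC D a b : dl D a b = dl D b a.
Proof. by rewrite /dl setUC. Qed.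

Lemma dlDNr D a b : dl D a (b + N) = dl D a b.
Proof. by rewrite /dl vtxDN. Qed.

Lemma dlDNl D a b : dl D (a + N) b = dl D a b.
Proof. by rewrite /dl vtxDN. Qed.

Lemma dissection_diag D e : dissection D -> e \in D -> is_diagonal e.
Proof. by case/andP=> /forall_inP h _ /h. Qed.

(** The diagonal may be found with its ends exchanged; its length is then [N - (y - x)], and the
    range from [2] to [n] is symmetric under this exchange. *)
Lemma dl_range D a b : dissection D -> a < b < a + N -> dl D a b -> a.+2 <= b <= a + n.
Proof.
move=> dD hb /(dissection_diag dD)/is_diagonalP [x [y [hxy /set2_eq E]]].
have [z hz Ez] := vtx_lift x (vtx a).
have [w hw Ew] := vtx_lift x (vtx b).
have Eza : z = a %[mod N] by apply/eqP; rewrite -vtx_mod Ez.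
have Ewb : w = b %[mod N] by apply/eqP; rewrite -vtx_mod Ew.
suff : (z = x /\ w = y) \/ (z = y /\ w = x).
  case=> [[? ?]|[? ?]]; subst.
    have : vtx b = vtx (a + (y - x)).
      by apply/eqP; rewrite vtx_mod -Ewb -modnDml -Eza modnDml subnKC //; lia.
    move/(@vtx_inj a) => -> //; lia.
  have : vtx b = vtx (a + (x + N - y)).
    apply/eqP; rewrite vtx_mod -Ewb -modnDml -Eza modnDml.
    have -> : y + (x + N - y) = x + N by lia.
    by rewrite modnDr.
  move/(@vtx_inj a) => -> //; lia.
by case: E => [[E1 E2]|[E1 E2]]; [left|right]; split; apply: (@vtx_inj x); rewrite ?Ez ?Ew //; lia.
Qed.

Lemma dl_nocross D a c b d : dissection D -> a < c < b -> b < d < a + N ->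
  dl D a b -> dl D c d -> False.
Proof.
move=> /andP [_ /forall_inP h] h1 h2 /h/forall_inP h' /h'/negP; apply.
apply/existsP; exists (vtx c); apply/existsP; exists (vtx d).
by rewrite eqxx separates_vtx; lia.
Qed.

Lemma dissection_intro D :
  (forall e, e \in D -> is_diagonal e) ->
  (forall a c b d, a < c < b -> b < d < a + N -> dl D a b -> dl D c d -> False) ->
  dissection D.
Proof.
move=> hdiag hcross; apply/andP; split; first exact/forall_inP.
apply/forall_inP => e De; apply/forall_inP => f Df.
apply/negP => /existsP [x /existsP [y /andP [/eqP Ef]]].
have /is_diagonalP [a [b [hb Ee]]] := hdiag _ De; subst e f.
have [z hz Ez] := vtx_lift a x; have [w hw Ew] := vtx_lift a y.
subst x y; rewrite separates_vtx //; last by lia.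
case/orP=> h.
  by apply: (hcross a z b w _ _ De Df); lia.
by rewrite /= setUC in Df; apply: (hcross a w b z _ _ De Df); lia.
Qed.

Definition uncut D S := forall a z b w,
  a < z < b -> b < w < a + N -> dl D a b -> vtx z \in S -> vtx w \in S -> False.

(* A face of [D], or a diagonal of [D] seen as a face with two vertices. *)
Definition core D S := [/\ 1 < #|S|, uncut D S &
  forall x y, x < y < x + N -> vtx x \in S -> vtx y \in S ->
    (forall z, x < z < y -> vtx z \notin S) -> y = x.+1 \/ dl D x y].

Lemma card_le2_consecutive x y S : x < y -> vtx x \in S ->
  (forall z, x < z < x + N -> vtx z \in S -> z = y) -> #|S| <= 2.
Proof.
move=> xy Sx h; have : S \subset [set vtx x; vtx y].
  apply/subsetP => i Si; have [z hz Ez] := vtx_lift x i; subst i.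
  rewrite !inE; case: (ltngtP x z) => [xz|zx|->]; [|lia|by rewrite eqxx].
  by rewrite (h z) ?eqxx ?orbT //; lia.
by move/subset_leq_card => h'; apply: leq_trans h' _; rewrite cards2; case: (_ == _).
Qed.

(** [is_side] ignores direction, while [core] accepts only [y = x.+1]. The reverse case
    [y = x + N - 1], with nothing of [S] in between, would leave only two vertices. *)
Lemma subgonP D S : dissection D -> subgon D S <-> 2 < #|S| /\ core D S.
Proof.
move=> dD; split=> [/and3P [hc /forallP h2 /forall_inP h3]|[hc [_ unc hcons]]].
  split=> //; split=> [|a z b w hz hw Dab Sz Sw|x y hxy Sx Sy hxyz]; first exact: ltnW.
    have /forall_inP h4 := forall_inP (h3 _ Dab) _ Sz.
    by move: (h4 _ Sw); rewrite separates_vtx; lia.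
  have : consec S (vtx x) (vtx y).
    rewrite /consec Sx Sy /=; apply/andP; split.
      by apply/eqP => /(@vtx_inj x); lia.
    apply/forall_inP => i Si; have [z hz Ez] := vtx_lift x i; subst i.
    rewrite arc_between_vtx //; last lia.
    by apply/negP => /hxyz; rewrite Si.
  move/forallP: (h2 (vtx x)) => /(_ (vtx y)) /implyP h /h.
  rewrite is_side_vtx // => /orP [/orP [/eqP ->|/eqP hN]|]; [by left| |by right].
  have : #|S| <= 2.
    apply: (@card_le2_consecutive x y S _ Sx) => [|z hz Sz]; first lia.
    apply/eqP; case: eqP => // nzy.
    by have := hxyz z; rewrite Sz => /(_ ltac:(lia)).
  by rewrite leqNgt hc.
apply/and3P; split=> //.
  apply/forallP => i; apply/forallP => j; apply/implyP => /and4P [Si Sj nij hb].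
  have [y hy Ey] := vtx_lift i j; rewrite -(vtx_val i) in Si nij hb *; subst j.
  have nyi : y <> i by move=> E; rewrite E eqxx in nij.
  case: (hcons i y) => // [|z hz||].
  - lia.
  - apply/negP => Sz; move/forall_inP: hb => /(_ _ Sz).
    by rewrite arc_between_vtx; lia.
  - by move=> ->; rewrite is_side_vtx ?eqxx //; lia.
  - by rewrite /dl => ->; rewrite orbT.
apply/forall_inP => e De; apply/forall_inP => i Si; apply/forall_inP => j Sj.
have /is_diagonalP [a [b [hb Ee]]] := dissection_diag dD De; subst e.
have [z hz Ez] := vtx_lift a i; have [w hw Ew] := vtx_lift a j; subst i j.
rewrite separates_vtx //; last lia.
by apply/negP => /orP [] h; [apply: (unc a z b w)|apply: (unc a w b z)] => //; lia.
Qed.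

(** A core with two vertices has a side or a diagonal both ways round; for [0 < n] these cannot both
    be sides, so the pair is a diagonal. For [n = 0] the digon is a core of neither kind. *)
Lemma coreP D S : 0 < n -> dissection D -> (S \in D) || subgon D S <-> core D S.
Proof.
move=> n0 dD; split=> [/orP [SD|/(subgonP S dD) []//]|cS].
  have /is_diagonalP [a [b [hb Ee]]] := dissection_diag dD SD.
  have nab : vtx a != vtx b by apply/eqP => /(@vtx_inj a); lia.
  split; first by rewrite Ee cards2 nab.
    move=> c z d w hz hw Dcd Sz Sw; apply: (dl_nocross dD hz hw Dcd).
    have nzw : vtx z <> vtx w by move/(@vtx_inj c); lia.
    rewrite /dl; move: SD; rewrite Ee in Sz Sw *.
    by move: Sz Sw nzw; rewrite !inE => /orP [] /eqP -> /orP [] /eqP -> // _; rewrite setUC.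
  move=> x y hxy Sx Sy _; right.
  have nxy : vtx x <> vtx y by move/(@vtx_inj x); lia.
  rewrite /dl; move: SD; rewrite Ee in Sx Sy *.
  by move: Sx Sy nxy; rewrite !inE => /orP [] /eqP -> /orP [] /eqP -> // _; rewrite setUC.
have [c1 unc hcons] := cS.
case: (ltnP 2 #|S|) => h; first by apply/orP; right; apply/subgonP.
have /cards2P [i [j [nij ES]]] : #|S| == 2 by lia.
have [y hy Ey] := vtx_lift i j; rewrite -(vtx_val i) in nij ES; subst j.
have nyi : y <> i by move=> E; rewrite E eqxx in nij.
have memS z : i <= z < i + N -> vtx z \in S -> z = i \/ z = y.
  move=> hz; rewrite ES !inE => /orP [] /eqP /(@vtx_inj i) ->; auto; lia.
have Si : vtx i \in S by rewrite ES !inE eqxx.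
have Sy : vtx y \in S by rewrite ES !inE eqxx orbT.
apply/orP; left; rewrite ES.
case: (hcons i y) => // [|z hz|Ey]; first lia.
  by apply/negP => /memS; lia.
rewrite setUC; case: (hcons y (i + N)) => //; first lia.
- by rewrite vtxDN.
- by move=> z hz; apply/negP => /memS; lia.
- lia.
- by rewrite dlDNr.
Qed.
End Lift.

(** * Arc systems *)

Section Arcs.
Variable n : nat.
Local Notation N := n.+2.
Implicit Types (a b c d x y z w : nat) (D : {set {set 'I_N}}) (S : {set 'I_N}).
Implicit Types (L : nat -> nat -> bool).

(* [L a b] encodes the arc from [vtx a] clockwise to [vtx b]; the positions are
   integers rather than residues, so that strict betweenness is linear. *)
Definition arcsys L := [/\ forall a b, L a b -> a.+1 < b < a + N,
  forall a b, L (a + N) (b + N) = L a b &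
  forall a c b d, L a b -> L c d -> a < c < b -> d <= b].

Definition covered L z := has (fun a => has (L a) (iota z.+1 N)) (iota 0 z).
(** The test is made one turn later because positions are natural numbers: an arc over [i] may have
    to start before [0], but its translate over [i + N] does not. *)
Definition outer L : {set 'I_N} := [set i : 'I_N | ~~ covered L (i + N)].
Definition chords L : {set {set 'I_N}} :=
  [set e | [exists a : 'I_N, exists b : 'I_(N + N), L a b && (e == [set vtx n a; vtx n b])]].

Section Fixed.
Variable L : nat -> nat -> bool.
Hypothesis sysL : arcsys L.

Let rangeL a b : L a b -> a.+1 < b < a + N.
Proof. by case: sysL => h _ _; apply: h. Qed.
Let perL a b : L (a + N) (b + N) = L a b.
Proof. by case: sysL. Qed.
Let crossL a c b d : L a b -> L c d -> a < c < b -> d <= b.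
Proof. by case: sysL => _ _; apply. Qed.

Lemma coveredP z : reflect (exists a b, L a b /\ a < z < b) (covered L z).
Proof.
apply: (iffP hasP) => [[a]|[a [b [Lab hz]]]].
  rewrite mem_iota => ha /hasP [b]; rewrite mem_iota => hb Lab.
  by exists a, b; split=> //; lia.
exists a; first by rewrite mem_iota; lia.
apply/hasP; exists b => //; rewrite mem_iota.
by have := rangeL Lab; lia.
Qed.

Lemma coveredDN z : N <= z -> covered L (z + N) = covered L z.
Proof.
move=> hz; apply/coveredP/coveredP => [] [a [b [Lab h]]].
  by have := rangeL Lab => h1; exists (a - N), (b - N); rewrite -perL !subnK; lia.
by exists (a + N), (b + N); rewrite perL; split=> //; lia.
Qed.

Lemma mem_outer z : N <= z -> (vtx n z \in outer L) = ~~ covered L z.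
Proof.
move=> hz; rewrite inE /=; congr (~~ _).
have := divn_eq z N; move: (ltn_pmod z (isT : 0 < N)).
case: (z %/ N) => [|k]; first by lia.
move: (z %% N) => r hr ->.
elim: k => [|k IH]; first by rewrite mul1n addnC.
by rewrite IH [k.+2 * N]mulSn -addnA [N + _]addnC coveredDN //; lia.
Qed.

Lemma arc_congr a x t : vtx n a = vtx n x -> L a (a + t) = L x (x + t).
Proof.
wlog le_ax : a x / a <= x => [IH E|].
  by case: (leqP a x) => [/IH->//|/ltnW/IH ->].
move/eqP; rewrite vtx_mod eq_sym (eqn_mod_dvd N le_ax) => /dvdnP [k Ek].
have -> : x = a + k * N by lia.
elim: k {Ek} => [|k IH]; first by rewrite addn0.
by rewrite IH -perL mulSn; congr L; lia.
Qed.

Lemma chordsP e : reflect (exists a b, L a b /\ e = [set vtx n a; vtx n b]) (e \in chords L).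
Proof.
rewrite inE; apply: (iffP existsP) => [[a /existsP [b /andP [Lab /eqP ->]]]|].
  by exists a, b.
move=> [a [b [Lab ->]]]; have := rangeL Lab => hab.
have Ea : vtx n (vtx n a) = vtx n a by rewrite vtx_val.
have hb : vtx n a + (b - a) < N + N by have := ltn_ord (vtx n a); lia.
exists (vtx n a); apply/existsP; exists (Ordinal hb).
rewrite -[nat_of_ord (Ordinal hb)]/(vtx n a + (b - a)) (arc_congr _ Ea).
rewrite subnKC ?Lab ?vtx_val; last lia.
apply/eqP; congr [set _ ; _]; apply/eqP.
by rewrite vtx_mod /= modnDml subnKC //; lia.
Qed.

Lemma dl_chords a b : a < b < a + N -> dl (chords L) a b <-> L a b \/ L b (a + N).
Proof.
move=> hab; split=> [/chordsP [x [y [Lxy]]]|[] Lab]; last first.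
- by rewrite dlC -dlDNr; apply/chordsP; exists b, (a + N).
- by apply/chordsP; exists a, b.
have hxy := rangeL Lxy.
have Ly : L x (x + (y - x)) by rewrite subnKC //; lia.
have off c (E : vtx n c = vtx n x) : vtx n y = vtx n (c + (y - x)).
  apply/eqP; rewrite vtx_mod -modnDml.
  by move/eqP: E; rewrite vtx_mod => /eqP ->; rewrite modnDml subnKC //; lia.
case/set2_eq => [] [E1 E2]; [left|right].
  have <- : a + (y - x) = b.
    by apply: (@vtx_inj n a); [lia|lia|rewrite -off ?E2].
  by rewrite (arc_congr _ E1).
have <- : b + (y - x) = a + N.
  by apply: (@vtx_inj n b); [lia|lia|rewrite -off ?vtxDN ?E1].
by rewrite (arc_congr _ E2).
Qed.

Lemma outer_arc a b z : L a b -> a < z < b -> vtx n z \notin outer L.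
Proof.
move=> Lab hz; rewrite -vtxDN mem_outer ?negbK; last lia.
by apply/coveredP; exists (a + N), (b + N); rewrite perL; split=> //; lia.
Qed.

(** The longest arc from [x] must end at [y]. If it ended earlier, its end would be covered by an
    arc that covers [x], crosses the longest one, or starts at [x] and is longer. *)
Lemma outer_consec x y : x < y < x + N -> vtx n x \in outer L -> vtx n y \in outer L ->
  (forall z, x < z < y -> vtx n z \notin outer L) -> y = x.+1 \/ L x y.
Proof.
wlog hx : x y / N <= x => [IH hxy|].
  rewrite -(vtxDN _ x) -(vtxDN _ y) => fx fy h.
  case: (IH (x + N) (y + N)) => //; try lia; last by rewrite perL; right.
  move=> z hz; have := h (z - N); rewrite -vtxDN subnK; last by lia.
  by apply; lia.
move=> hxy fx fy fz; case: (ltnP x.+1 y) => [xy|]; last by left; lia.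
right; have : exists b, L x b && (x.+1 < b).
  have : covered L x.+1 by rewrite -[covered _ _]negbK -mem_outer ?fz //; lia.
  case/coveredP => a [b [Lab hab]]; case: (ltngtP a x) => h; try lia.
    by move: fx; rewrite (negPf (outer_arc Lab _)) //; lia.
  by exists b; rewrite -h Lab; lia.
move=> exb; have ub b : L x b && (x.+1 < b) -> b <= x + N.
  by case/andP => /rangeL; lia.
case: (ex_maxnP exb ub) => b /andP [Lxb hxb] maxb.
case: (ltngtP b y) => [lt_by|lt_yb|<- //]; last first.
  by move: fy; rewrite (negPf (outer_arc Lxb _)) //; lia.
have : covered L b by rewrite -[covered _ _]negbK -mem_outer ?fz //; lia.
case/coveredP => a [b' [Lab hab]]; case: (ltngtP a x) => h.
- by move: fx; rewrite (negPf (outer_arc Lab _)) //; lia.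
- by have := crossL Lxb Lab; lia.
- by have := maxb b'; rewrite -h Lab; lia.
Qed.

(** Without arcs every vertex is outer. Otherwise both ends of a longest arc are: an arc strictly
    over an end would cross it or be longer. *)
Lemma card_outer : 1 < #|outer L|.
Proof.
case: (boolP [exists i : 'I_N, [exists j : 'I_(N + N), L i j]]) => [|none]; last first.
  suff -> : outer L = setT by rewrite cardsT card_ord.
  apply/setP => i; rewrite !inE; apply/coveredP => [] [a [b [Lab _]]].
  case/negP: none; have : [set vtx n a; vtx n b] \in chords L by apply/chordsP; exists a, b.
  rewrite inE => /existsP [x /existsP [y /andP [Lxy _]]].
  by apply/existsP; exists x; apply/existsP; exists y.
case/existsP => i0 /existsP [j0 L0].
pose P k := [exists i : 'I_N, L i (i + k)].
have exP : exists k, P k.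
  by exists (j0 - i0); apply/existsP; exists i0; rewrite subnKC //; have := rangeL L0; lia.
have ubP k : P k -> k <= N by case/existsP => i /rangeL; lia.
case: (ex_maxnP exP ubP) => k /existsP [i Lik] maxk.
have {}maxk a b : L a b -> b <= a + k.
  move=> Lab; have hab := rangeL Lab.
  suff /maxk : P (b - a) by lia.
  apply/existsP; exists (vtx n a).
  by rewrite (@arc_congr _ a) ?subnKC ?vtx_val //; lia.
pose a := i + N; pose b := a + k.
have Lab : L a b by rewrite /a /b -(perL) in Lik *; rewrite -(_ : i + k + N = i + N + k) //; lia.
have hab := rangeL Lab.
have fa : vtx n a \in outer L.
  rewrite mem_outer; last lia.
  apply/coveredP => [] [c [d [Lcd hcd]]].
  by have := maxk _ _ Lcd; have := crossL Lcd Lab; lia.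
have fb : vtx n b \in outer L.
  rewrite mem_outer; last lia.
  apply/coveredP => [] [c [d [Lcd hcd]]].
  by have := maxk _ _ Lcd; have := crossL Lab Lcd; lia.
have nab : vtx n a != vtx n b by apply/eqP => /(@vtx_inj n a); lia.
have <- : #|[set vtx n a; vtx n b]| = 2 by rewrite cards2 nab.
by apply/subset_leq_card/subsetP => j; rewrite in_set2 => /orP [] /eqP ->.
Qed.

Lemma outer_core D : (forall a b, a < b < a + N -> dl D a b <-> L a b \/ L b (a + N)) ->
  core D (outer L).
Proof.
move=> hD; split; first exact: card_outer.
  move=> a z b w hz hw Dab Sz Sw; case: (proj1 (hD a b ltac:(lia)) Dab) => Lab.
    by rewrite (negPf (outer_arc Lab hz)) in Sz.
  by rewrite (negPf (outer_arc Lab hw)) in Sw.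
move=> x y hxy Sx Sy h; case: (outer_consec hxy Sx Sy h); first by left.
by move=> Lxy; right; apply/hD; auto.
Qed.

(** The bound excludes [b = a + n.+1], which [arcsys] admits although the chord is then a side. *)
Lemma chords_dissection : (forall a b, L a b -> b <= a + n) -> dissection (chords L).
Proof.
move=> bndL; apply: dissection_intro => [e /chordsP [a [b [Lab ->]]]|].
  by apply/is_diagonalP; exists a, b; split=> //; have := bndL _ _ Lab; have := rangeL Lab; lia.
move=> a c b d hc hd /dl_chords h1 /dl_chords h2.
case: (h1 ltac:(lia)) => {h1} Lab; case: (h2 ltac:(lia)) => {h2} Lcd.
- by have := crossL Lab Lcd; lia.
- by rewrite -perL in Lab; have := crossL Lcd Lab; lia.
- by have := crossL Lcd Lab; lia.
- by have := crossL Lab Lcd; lia.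
Qed.

End Fixed.

(** Each diagonal is directed so that its open arc misses [S]. If [S] is itself a diagonal, both of
    its directions qualify. *)
Definition arcs_of D S a b :=
  [&& a < b, b < a + N, dl D a b & all (fun z => vtx n z \notin S) (iota a.+1 (b - a.+1))].

Lemma arcs_ofP D S a b : reflect
  [/\ a < b < a + N, dl D a b & forall z, a < z < b -> vtx n z \notin S] (arcs_of D S a b).
Proof.
apply: (iffP and4P) => [[h1 h2 h3 /allP h4]|[h1 h2 h3]].
  by split=> // [|z hz]; [lia|apply: h4; rewrite mem_iota; lia].
split=> //; try lia; apply/allP => z; rewrite mem_iota => hz; apply: h3; lia.
Qed.

Section Core.
Variables (D : {set {set 'I_N}}) (S : {set 'I_N}).
Hypotheses (dD : dissection D) (cS : core D S).

Lemma arcs_of_bound a b : arcs_of D S a b -> b <= a + n.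
Proof. by case/arcs_ofP => h1 h2 _; have := dl_range dD h1 h2; lia. Qed.

Lemma core_far a (hS : forall z, a < z < a + N -> vtx n z \notin S) : False.
Proof.
have [c1 _ _] := cS; suff : #|S| <= #|[set vtx n a]| by rewrite cards1; lia.
apply/subset_leq_card/subsetP => i Si; have [z hz Ez] := vtx_lift a i; subst i.
case: (ltngtP a z) => [az||->]; [|lia|by rewrite inE].
by move: Si; rewrite (negPf (hS _ _)) //; lia.
Qed.

(** Overlapping arcs that fit in one turn come from crossing diagonals. If together they go all the
    way round, no vertex other than [a] is left for [S]. *)
Lemma arcs_of_sys : arcsys (arcs_of D S).
Proof.
split=> [a b /arcs_ofP [h1 h2 _]|a b|a c b d /arcs_ofP [h1 h2 h3] /arcs_ofP [h4 h5 h6] h].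
- by have := dl_range dD h1 h2; lia.
- apply/arcs_ofP/arcs_ofP => [] []; rewrite dlDNr dlDNl => h1 h2 h3; split=> //; try lia.
    by move=> z hz; rewrite -vtxDN; apply: h3; lia.
  move=> z hz; have := h3 (z - N); rewrite -vtxDN subnK; last lia.
  by apply; lia.
case: (leqP d b) => // bd; exfalso; case: (ltnP d (a + N)) => hd.
  by apply: (dl_nocross dD _ _ h2 h5); lia.
apply: (@core_far a) => z hz; case: (ltnP z b) => hzb; [apply: h3|apply: h6]; lia.
Qed.

(** A vertex outside [S] lies between two successive vertices of [S]; these are not neighbours, so
    [core] provides a diagonal over it. *)
Lemma outer_arcs_of : outer (arcs_of D S) = S.
Proof.
have sys := arcs_of_sys; have [c1 _ hcons] := cS.
apply/setP => i; have [z hz Ez] := vtx_lift (N + N) i; subst i.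
rewrite mem_outer //; last lia.
apply/idP/idP => [|Sz]; last first.
  by apply/negP => /(coveredP sys) [a [b [/arcs_ofP [_ _ h] /h]]]; rewrite Sz.
apply: contraNT => Sz; apply/(coveredP sys).
have [i Si] : exists i, i \in S by apply/card_gt0P; lia.
have ex1 : exists k, (k <= z) && (vtx n (z - k) \in S).
  have [y hy Ey] := vtx_lift (z - N) i; exists (z - y); rewrite leq_subr subKn ?Ey //; lia.
have ex2 : exists y, (z < y) && (vtx n y \in S).
  by have [y hy Ey] := vtx_lift z.+1 i; exists y; rewrite Ey Si andbT; lia.
case: (ex_minnP ex1) => k /andP [kz Sk] mink; case: (ex_minnP ex2) => y /andP [zy Sy] miny.
pose x := z - k.
have xz : x < z.
  by rewrite ltn_neqAle leq_subr andbT; apply: contraNneq Sz => <-.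
have between t : x < t < y -> vtx n t \notin S.
  move=> ht; apply/negP => St; case: (ltngtP t z) => h.
  - by have := mink (z - t); rewrite subKn ?St; lia.
  - by have := miny t; rewrite St; lia.
  - by rewrite -h St in Sz.
have hy : y < x + N.
  rewrite ltnNge; apply/negP => hy; apply: (@core_far x) => t ht; apply: between; lia.
have Dxy : dl D x y.
  by case: (hcons x y) => //; try lia.
by exists x, y; split; [apply/arcs_ofP; split=> //; lia | lia].
Qed.

(** No diagonal cuts [S], so one of its two open arcs misses [S]. *)
Lemma chords_arcs_of : chords (arcs_of D S) = D.
Proof.
have sys := arcs_of_sys; have [c1 unc _] := cS.
apply/setP => e; apply/(chordsP sys)/idP => [[a [b [/arcs_ofP [_ h _] ->]]]//|De].
have /is_diagonalP [a [b [hb Ee]]] := dissection_diag dD De; subst e.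
case: (boolP [exists i : 'I_N, (vtx n a < vtx n a + (i + N - vtx n a) %% N < vtx n a + (b - a)) && (i \in S)]) => [|h1]; last first.
  exists a, b; split=> //; apply/arcs_ofP; split=> //; first lia.
  move=> z hz; apply/negP => Sz; case/negP: h1; apply/existsP; exists (vtx n z).
  by rewrite vtx_offset ?Sz; lia.
case/existsP => i /andP [hi Si]; have [z hz Ez] := vtx_lift a i; subst i.
rewrite vtx_offset // in hi.
exists b, (a + N); rewrite vtxDN setUC; split=> //; apply/arcs_ofP; split; first lia.
  by rewrite dlDNr dlC.
by move=> w hw; apply/negP => Sw; apply: (unc a z b w) => //; lia.
Qed.
End Core.

(** A vertex of [S'] outside [S] lies under an arc away from [S]. The chord of that arc does not cut
    [S'], so only its two ends can be common to both sets. *)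
Lemma core_sub D S S' : dissection D -> core D S -> uncut D S' -> 2 < #|S :&: S'| -> S' \subset S.
Proof.
move=> dD cS unc c3; have sys := arcs_of_sys dD cS.
apply/subsetP => i Si'; apply: contraTT c3 => Si; rewrite -leqNgt.
have [z hz Ez] := vtx_lift (N + N) i; subst i; move: Si.
rewrite -{1}(outer_arcs_of dD cS) mem_outer //; last lia.
rewrite negbK => /(coveredP sys) [a [b [Lab hz']]].
have /arcs_ofP [hab Dab hS] := Lab.
have : S :&: S' \subset [set vtx n a; vtx n b].
  apply/subsetP => i; rewrite inE => /andP [Si Si2].
  have [w hw Ew] := vtx_lift a i; subst i; rewrite !inE.
  case: (ltngtP a w) => [aw||->]; [|lia|by rewrite eqxx].
  case: (ltngtP w b) => [wb|bw|->]; last by rewrite eqxx orbT.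
    by have := hS w; rewrite Si aw wb => /(_ isT).
  by case: (unc a z b w) => //; lia.
by move/subset_leq_card => h; apply: leq_trans h _; rewrite cards2; case: (_ == _).
Qed.

Lemma subgon_eq D S S' : dissection D -> subgon D S -> subgon D S' -> 2 < #|S :&: S'| -> S = S'.
Proof.
move=> dD /(subgonP S dD) [_ cS] /(subgonP S' dD) [_ cS'] c3.
have [_ u _] := cS; have [_ u' _] := cS'.
by apply/eqP; rewrite eqEsubset !(core_sub dD) // setIC.
Qed.

(** Only the reverse of an arc could be added. Its open arc misses the outer vertices only if these
    are just the two ends, and then [outer_consec] makes the reverse an arc of [L] as well. *)
Lemma arcs_of_chords L : arcsys L -> (forall a b, L a b -> b <= a + n) ->
  forall a b, arcs_of (chords L) (outer L) a b = L a b.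
Proof.
move=> sys bnd a b; have [rangeL perL crossL] := sys.
apply/arcs_ofP/idP => [[h1 h2 h3]|Lab]; last first.
  by split=> [||z hz]; [have := rangeL _ _ Lab; lia |
    apply/dl_chords; rewrite ?Lab; auto; have := rangeL _ _ Lab; lia | exact: outer_arc Lab hz].
case: (proj1 (dl_chords sys h1) h2) => // Lba.
have fcase i : i \in outer L -> i = vtx n a \/ i = vtx n b.
  have [z hz Ez] := vtx_lift a i; subst i => fz.
  case: (ltngtP a z) => [az||->]; [|lia|by left].
  case: (ltngtP z b) => [zb|bz|->]; last by right.
    by move: fz; rewrite (negPf (h3 _ _)) //; lia.
  by move: fz; rewrite (negPf (outer_arc sys Lba _)) //; lia.
have fab : vtx n a \in outer L /\ vtx n b \in outer L.
  have /card_gt1P [i [j [/fcase hi /fcase hj nij]]] := card_outer sys.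
  have /card_gt1P [i' [j' [fi fj nij']]] := card_outer sys.
  by case: (fcase _ fi) (fcase _ fj) => ? [] ?; subst; rewrite ?eqxx // in nij' *; auto.
case: (outer_consec sys h1 (proj1 fab) (proj2 fab) h3) => // E.
by have := bnd _ _ Lba; lia.
Qed.

End Arcs.

(** * From words to arc systems *)

Section Word.
Variables (n c : nat) (W : nat -> seq nat).
Local Notation N := n.+2.
Implicit Types (a b x y z t p : nat) (S : {set 'I_N}).

(* The height: every vertex is a step up, every letter [l] a step down by [l]. *)
Definition height t : int := (t%:Z - (\sum_(0 <= x < t) sumn (W x))%:Z)%R.
Local Notation H := height.

Lemma heightS t : H t.+1 = (H t + 1 - (sumn (W t))%:Z)%R.
Proof. by rewrite /H big_nat_recr //=; lia. Qed.

(** Strict record of the path after [a]. The path climbs by at most one per step, so these are the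
    first passages at the heights from [H a.+1] upwards. *)
Definition rec a b := (a < b) && all (fun t => H t < H b)%R (iota a.+1 (b - a.+1)).

Lemma recP a b : reflect (a < b /\ forall t, a < t < b -> (H t < H b)%R) (rec a b).
Proof.
apply: (iffP andP) => [] [h1 h2]; split=> //.
  by move=> t ht; move/allP: h2; apply; rewrite mem_iota; lia.
by apply/allP => t; rewrite mem_iota => ht; apply: h2; lia.
Qed.

(** [H a.+1 + tail_sum a p] is the height just before letter [p] of the word at [a] is read. *)
Definition tail_sum a p := sumn (drop p (W a)).
Local Notation sig := tail_sum.

Lemma tail_sum0 a : sig a 0 = sumn (W a).
Proof. by rewrite /sig drop0. Qed.

Lemma tail_sumS a p : sig a p = nth 0 (W a) p + sig a p.+1.
Proof.
rewrite /sig; case: (ltnP p (size (W a))) => h; first by rewrite (drop_nth 0 h).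
by rewrite nth_default // !drop_oversize // ltnW.
Qed.

Lemma tail_sum_size a p : size (W a) <= p -> sig a p = 0.
Proof. by move=> h; rewrite /sig drop_oversize. Qed.

Lemma tail_sum_le a p q : p <= q -> sig a q <= sig a p.
Proof.
move/subnK <-; elim: (q - p) => // k IH; apply: leq_trans IH.
by rewrite addSn [X in _ <= X]tail_sumS leq_addl.
Qed.

Definition arcW a b :=
  rec a b && has (fun p => H b == (H a.+1 + (sig a p)%:Z)%R) (iota 0 (size (W a))).

Lemma arcWP a b : reflect
  (exists p, [/\ p < size (W a), rec a b & H b = (H a.+1 + (sig a p)%:Z)%R]) (arcW a b).
Proof.
apply: (iffP andP) => [[h1 /hasP [p hp /eqP h2]]|[p [h1 h2 h3]]].
  by exists p; move: hp; rewrite mem_iota; split=> //; lia.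
by split=> //; apply/hasP; exists p; rewrite ?h3 // mem_iota; lia.
Qed.

Lemma rec_lt a x y : rec a x -> rec a y -> (x < y) = (H x < H y)%R.
Proof.
move=> /recP [ax hx] /recP [ay hy]; case: (ltngtP x y) => [xy|yx|->].
- by rewrite hy //; lia.
- by have := hx y; lia.
- by lia.
Qed.

Lemma rec_inj a x y : rec a x -> rec a y -> H x = H y -> x = y.
Proof.
by move=> hx hy E; have := rec_lt hx hy; have := rec_lt hy hx; rewrite E; lia.
Qed.

Lemma arcW_shift m e : (forall t, W (t + m) = W t) -> (forall t, H (t + m) = (H t + e)%R) ->
  forall a b, arcW (a + m) (b + m) = arcW a b.
Proof.
move=> Wm Hm a b; have Hlt x y : (H (x + m) < H (y + m) = (H x < H y))%R by rewrite !Hm; lia.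
rewrite /arcW /tail_sum Wm -addSn !Hm; congr (_ && _).
  apply/recP/recP => [] [h1 h2]; split; try lia; move=> t ht.
    by have := h2 (t + m); rewrite Hlt; apply; lia.
  by have := h2 (t - m); rewrite -Hlt subnK; [apply|]; lia.
by apply: eq_has => p /=; apply/eqP/eqP; lia.
Qed.

Lemma height_shift m : (forall t, W (t + m) = W t) -> forall t, H (t + m) = (H t + H m)%R.
Proof.
move=> Wm; elim=> [|t IH]; first by rewrite add0n {2}/H big_geq // add0r.
by rewrite addSn !heightS IH Wm; lia.
Qed.

(** * Paths of periodic positive words with net climb [c] per turn *)

Hypothesis WN : forall t, W (t + N) = W t.
Hypothesis Wpos : forall t, all (ltn 0) (W t).
Hypothesis c_gt1 : 1 < c.
Hypothesis HN : forall t, H (t + N) = (H t + c%:Z)%R.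

Lemma letter_pos a p : p < size (W a) -> 0 < nth 0 (W a) p.
Proof. by move=> h; apply: (allP (Wpos a)); apply: mem_nth. Qed.

Lemma tail_sum_lt a p q : p < q -> p < size (W a) -> sig a q < sig a p.
Proof.
move=> pq hp; apply: leq_ltn_trans (tail_sum_le a pq) _.
by rewrite [X in _ < X]tail_sumS -{1}[sig a p.+1]add0n ltn_add2r letter_pos.
Qed.

Lemma height_unbounded t k : (H t + k%:Z <= H (t + k * N))%R.
Proof.
elim: k => [|k IH]; first by rewrite addr0 addn0.
have -> : t + k.+1 * N = t + k * N + N by rewrite mulSn; lia.
by rewrite HN; lia.
Qed.

Lemma first_passage a k : exists b, rec a b && (H b == H a.+1 + k%:Z)%R.
Proof.
have ex : exists b, (a < b) && (H a.+1 + k%:Z <= H b)%R.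
  by exists (a.+1 + k * N); rewrite height_unbounded andbT; lia.
case: (ex_minnP ex) => b /andP [ab hb] minb.
have lt_b t : a < t < b -> (H t < H a.+1 + k%:Z)%R.
  by move=> ht; have := minb t; lia.
exists b; have Hb : H b = (H a.+1 + k%:Z)%R.
  case: (ltngtP a.+1 b) => h; [|lia|by rewrite -h in hb *; lia].
  have := heightS b.-1; rewrite (ltn_predK ab).
  by have := lt_b b.-1; lia.
by rewrite Hb eqxx andbT; apply/recP; rewrite Hb.
Qed.

Definition hit a k := xchoose (first_passage a k).

Lemma hit_rec a k : rec a (hit a k).
Proof. by case/andP: (xchooseP (first_passage a k)). Qed.

Lemma hit_height a k : H (hit a k) = (H a.+1 + k%:Z)%R.
Proof. by case/andP: (xchooseP (first_passage a k)) => _ /eqP. Qed.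

Lemma rec_height a x : rec a x -> (H a.+1 <= H x)%R.
Proof.
case/recP => ax h; case: (ltngtP a.+1 x) => [lt||->]; [|lia|lia].
by have := h a.+1; lia.
Qed.

Lemma hit0 a : hit a 0 = a.+1.
Proof.
apply: (@rec_inj a); [exact: hit_rec| |by rewrite hit_height addr0].
by apply/recP; split=> // t; lia.
Qed.

Lemma arcW_hit a p : p < size (W a) -> arcW a (hit a (sig a p)).
Proof. by move=> hp; apply/arcWP; exists p; rewrite hit_rec hit_height. Qed.

(** This is where [1 < c] enters: the path is already above [H a + 1] at [a + N], so no record that
    low comes later. *)
Lemma rec_short a b : rec a b -> (H b <= H a + 1)%R -> b < a + N.
Proof.
move=> /recP [ab h] hb; rewrite ltnNge; apply/negP => hN.
case: (ltngtP (a + N) b) => [lt||E]; [|lia|].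
  by have := h (a + N); rewrite HN; lia.
by move: hb; rewrite -E HN; lia.
Qed.

Lemma arcW_height a b : arcW a b -> (H a.+1 < H b <= H a + 1)%R.
Proof.
case/arcWP => p [hp _ ->]; have := tail_sum_lt (ltnSn p) hp.
by have := tail_sum_le a (leq0n p); rewrite tail_sum0 heightS; lia.
Qed.

Lemma arcW_sys : arcsys n arcW.
Proof.
split=> [a b Lab|a b|a x b y Lab Lxy hx].
- have /arcWP [p [hp hr _]] := Lab; have := arcW_height Lab.
  move=> h; have := rec_short hr; have /recP [ab _] := hr.
  case: (ltngtP a.+1 b) => [||E]; try lia.
  by move: h; rewrite E; lia.
- exact: arcW_shift HN a b.
(* If [b < y], the two records give [H x < H b < H y], but an arc ends at most one above its
   start. *)
- have /arcWP [_ [_ /recP [_ hab] _]] := Lab; have /arcWP [_ [_ /recP [_ hxy] _]] := Lxy.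
  by have := hab x; have := hxy b; have := arcW_height Lxy; lia.
Qed.

(** Take the last [a] before [y] that is at least as high as [y]. The path does not climb there, so
    the word at [a] has a first letter; its arc ends at height [H a + 1], hence beyond [y]. *)
Lemma arcW_over t y : t < y -> (H y <= H t)%R -> exists a b, t <= a /\ arcW a b /\ a < y < b.
Proof.
move=> ty hty; have ex : exists a, (a < y) && (H y <= H a)%R by exists t; rewrite ty.
have ub a : (a < y) && (H y <= H a)%R -> a <= y by lia.
case: (ex_maxnP ex ub) => a /andP [ay hya] maxa.
have ta : t <= a by apply: maxa; lia.
have sa : 0 < size (W a).
  rewrite lt0n; apply/eqP => /size0nil Wa; have := heightS a; rewrite Wa /= => Ha.
  case: (ltngtP a.+1 y) => [h||E]; [|lia|by move: hya; rewrite -E; lia].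
  by have := maxa a.+1; lia.
exists a, (hit a (sig a 0)); split=> //; split; first exact: arcW_hit.
have /recP [h1 h2] := hit_rec a (sig a 0); move: (hit_height a (sig a 0)).
rewrite {2}tail_sum0 => Hh; have := heightS a.
set b := hit _ _ in h1 h2 Hh *.
case: (ltngtP y b) => [|lt|E]; try lia.
  by have := maxa b; lia.
by rewrite -E in Hh; lia.
Qed.

Lemma outer_height z : N <= z -> vtx n z \in outer n arcW -> forall t, t < z -> (H t < H z)%R.
Proof.
move=> hz; rewrite (mem_outer arcW_sys) // => /(coveredP arcW_sys) h t ht.
rewrite ltNge; apply/negP => /(arcW_over ht) [a [b [_ [Lab hab]]]].
by case: h; exists a, b.
Qed.

Lemma height_outer z : N <= z -> (forall t, t < z -> (H t < H z)%R) -> vtx n z \in outer n arcW.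
Proof.
move=> hz h; rewrite (mem_outer arcW_sys) //; apply/(coveredP arcW_sys) => [] [a [b [Lab hab]]].
have /arcWP [_ [_ /recP [_ hr] _]] := Lab.
by have := hr z; have := h a; have := arcW_height Lab; lia.
Qed.

(** By [outer_height] and [height_outer] the outer vertices are the strict records of the whole
    path, and one turn contains exactly one at each of [c] successive heights. *)
Lemma card_outer_word : #|outer n arcW| = c.
Proof.
have [i fi] : exists i, i \in outer n arcW.
  by apply/card_gt0P; apply: ltnW; apply: card_outer arcW_sys.
(* Starting from the predecessor [y] makes [hit y 0] equal to [x]. *)
have [x hx Ex] := vtx_lift (N + N) i; subst i; pose y := x.-1.
have Ey : x = y.+1 by rewrite /y; lia.
have hfx := outer_height (ltac:(lia) : N <= x) fi.
have hfxN t : t < x + N -> (H t < H (x + N))%R.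
  by apply: outer_height; rewrite ?vtxDN //; lia.
have hit_lt k : k < c -> x <= hit y k < x + N.
  move=> kc; have /recP [h1 h2] := hit_rec y k; move: (hit_height y k); rewrite -Ey => hh.
  have := HN x; case: (ltnP (hit y k) (x + N)) => h; first lia.
  case: (ltngtP (hit y k) (x + N)) => [||E]; [lia| |rewrite -E; lia].
  by move=> h'; have := h2 (x + N); lia.
have -> : outer n arcW = [set:: [seq vtx n (hit y k) | k <- iota 0 c]].
  apply/setP => i; have [z hz Ez] := vtx_lift x i; subst i.
  rewrite [RHS]inE; apply/idP/mapP => [fz|[k]].
    have hfz := outer_height (ltac:(lia) : N <= z) fz.
    have hxz : (H x <= H z)%R by case: (ltngtP x z) hz => [/hfz||->]; lia.
    have hzx := hfxN z (ltac:(lia)); have E := HN x.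
    exists `|H z - H x|%N; first by rewrite mem_iota; lia.
    congr vtx; apply: (@rec_inj y); last by rewrite hit_height -Ey; lia.
      apply/recP; split; [lia|move=> t ht; apply: hfz; lia].
    exact: hit_rec.
  rewrite mem_iota => hk ->; have hh := hit_lt k ltac:(lia).
  apply: height_outer; first lia; move=> t ht.
  have /recP [h1 h2] := hit_rec y k; move: (hit_height y k); rewrite -Ey => Eh.
  by case: (ltngtP t x) => h; [have := hfx t h; lia|apply: h2; lia|
     case: (ltngtP y t) => h'; [apply: h2; lia| lia|lia]].
rewrite cardsE; have /card_uniqP -> : uniq [seq vtx n (hit y k) | k <- iota 0 c].
  rewrite map_inj_in_uniq ?iota_uniq // => k k'; rewrite !mem_iota => hk hk' E.
  have /(congr1 H) := @vtx_inj n x _ _ (hit_lt k ltac:(lia)) (hit_lt k' ltac:(lia)) E.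
  by rewrite !hit_height; lia.
by rewrite size_map size_iota.
Qed.

(** Besides [a] these are the first passages at all heights that letter [p] steps down through, both
    extremes included: one more than the letter. *)
Definition face a p : {set 'I_N} :=
  [set:: vtx n a :: [seq vtx n (hit a k) | k <- iota (sig a p.+1) (nth 0 (W a) p).+1]].

Section Face.
Variables a p : nat.
Hypothesis hp : p < size (W a).

Definition on_face z := z = a \/
  rec a z /\ (H a.+1 + (sig a p.+1)%:Z <= H z <= H a.+1 + (sig a p)%:Z)%R.

Lemma faceP i : reflect (exists z, on_face z /\ i = vtx n z) (i \in face a p).
Proof.
rewrite [face a p]/face inE in_cons.
apply: (iffP orP) => [[/eqP ->|/mapP [k]]|[z [[->|[hz hh]] ->]]].
- by exists a; split=> //; left.
- rewrite mem_iota => hk ->; exists (hit a k); split=> //; right.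
  by rewrite hit_rec hit_height; have := tail_sumS a p; lia.
- by left.
right; apply/mapP; exists `|H z - H a.+1|%N.
  by rewrite mem_iota; have := tail_sumS a p; lia.
congr vtx; apply: rec_inj hz _ _; first exact: hit_rec.
by rewrite hit_height; lia.
Qed.

Local Notation b := (hit a (sig a p)).

Lemma face_arc : arcW a b.
Proof. exact: arcW_hit. Qed.

Lemma face_arc_range : a.+1 < b < a + N.
Proof. by have [h _ _] := arcW_sys; apply/h/face_arc. Qed.

Lemma on_face_range z : on_face z -> a <= z <= b.
Proof.
move=> fz; have := face_arc_range; case: fz => [|[hz hh]]; first lia.
have /recP [az _] := hz; have := rec_lt (hit_rec a (sig a p)) hz.
by rewrite hit_height; lia.
Qed.

Lemma on_face_vtx z : a <= z < a + N -> vtx n z \in face a p -> on_face z.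
Proof.
move=> hz /faceP [y [hy E]]; have := on_face_range hy; have := face_arc_range => h1 h2.
by rewrite (@vtx_inj n a z y) //; lia.
Qed.

Lemma face_vtx z : on_face z -> vtx n z \in face a p.
Proof. by move=> h; apply/faceP; exists z. Qed.

Lemma on_face_hit k : sig a p.+1 <= k <= sig a p -> on_face (hit a k).
Proof. by right; rewrite hit_rec hit_height; lia. Qed.

Lemma on_face_end : on_face b.
Proof. by apply: on_face_hit; rewrite leqnn (tail_sum_le a (leqnSn p)). Qed.

Lemma face_inner : exists2 z, a < z < b & on_face z.
Proof.
have lt := tail_sum_lt (ltnSn p) hp.
exists (hit a (sig a p.+1)); last by apply: on_face_hit; lia.
have /recP [-> _] := hit_rec a (sig a p.+1).
by rewrite (rec_lt (hit_rec _ _) (hit_rec _ _)) !hit_height; lia.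
Qed.

Lemma card_face : #|face a p| = (nth 0 (W a) p).+2.
Proof.
rewrite cardsE; have /card_uniqP -> : uniq (vtx n a :: [seq vtx n (hit a k) |
    k <- iota (sig a p.+1) (nth 0 (W a) p).+1]).
  have rng k : k \in iota (sig a p.+1) (nth 0 (W a) p).+1 -> a < hit a k < a + N.
    rewrite mem_iota => hk; have := tail_sumS a p => E.
    have /on_face_range : on_face (hit a k) by apply: on_face_hit; lia.
    by have /recP [? _] := hit_rec a k; have := face_arc_range; lia.
  rewrite cons_uniq; apply/andP; split.
    apply/negP => /mapP [k /rng hk /(@vtx_inj n a)]; lia.
  rewrite map_inj_in_uniq ?iota_uniq // => k k' /rng hk /rng hk' E.
  have /(congr1 H) := @vtx_inj n a (hit a k) (hit a k') (ltac:(lia)) (ltac:(lia)) E.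
  by rewrite !hit_height; lia.
by rewrite /= size_map size_iota.
Qed.

Hypothesis aN : N <= a.

(** The arc cannot start strictly between [a] and [z], since [z] is a record from [a] and the arc
    climbs by at most one. Starting before [a], it nests around the base arc; starting at [a], it
    belongs to a letter of index at most [p]. *)
Lemma face_sub_arc x y z : arcW x y -> x < z < y -> on_face z -> x <= a /\ b <= y.
Proof.
move=> Lxy hz hfz; have [range _ cross] := arcW_sys; have Lab := face_arc.
have := on_face_range hfz => hab; have := range _ _ Lab => hab'.
have /arcWP [q [hq /recP [_ rxy] Hy]] := Lxy.
case: (ltngtP x a) => xa.
- split; first lia; case: (ltnP a y) => ay; last by lia.
  by apply: (cross x a); rewrite ?xa.
- exfalso; case: hfz => [|[/recP [_ hr] _]]; first lia.
  by have := hr x; have := rxy z; have := arcW_height Lxy; lia.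
- split; first lia; subst x; case: hfz => [|[hr hh]]; first lia.
  have := rxy z hz; rewrite Hy => hzq.
  have qp : q <= p.
    by case: (leqP q p) => // pq; have := tail_sum_le a pq; lia.
  have := tail_sum_le a qp => h.
  case: (leqP b y) => // yb; have /arcWP [_ [_ ry _]] := Lxy.
  by move: yb; rewrite (rec_lt ry (hit_rec _ _)) hit_height Hy; lia.
Qed.

Lemma face_uncut_arc x y z w : arcW x y -> x < z < y -> y < w < x + N ->
  vtx n z \in face a p -> vtx n w \notin face a p.
Proof.
move=> Lxy hz hw Fz; have [range _ _] := arcW_sys; have := range _ _ Lxy => hxy.
have [z' hz' Ez] := vtx_lift a (vtx n z).
(* The subtraction is not truncated: [z - x < N <= a <= z']. *)
pose x' := z' - (z - x).
have Ex : vtx n x' = vtx n x.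
  have := vtx_congr (x + N - z) Ez.
  have -> : z + (x + N - z) = x + N by lia.
  have -> : z' + (x + N - z) = x' + N by lia.
  by rewrite !vtxDN.
have Lxy' : arcW x' (x' + (y - x)).
  by rewrite (arc_congr arcW_sys _ Ex) subnKC //; lia.
have hfz : on_face z' by apply: on_face_vtx; rewrite ?Ez.
have [h1 h2] := face_sub_arc Lxy' (ltac:(lia) : x' < z' < x' + (y - x)) hfz.
apply/negP => Fw; have [w' hw' Ew] := vtx_lift a (vtx n w).
have /on_face_range hfw : on_face w' by apply: on_face_vtx; rewrite ?Ew.
have E : w' = x' + (w - x).
  apply: (@vtx_inj n x'); try lia.
  by rewrite Ew -(vtx_congr (w - x) (esym Ex)) subnKC //; lia.
by lia.
Qed.

(** From [a] to the lowest passage there is a side if [p] is the last letter, and otherwise the arc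
    of letter [p.+1]. Between passages the path gains one, by a side or by the arc of the first
    letter at [x]. The boundary closes with the base arc read backwards. *)
Lemma face_core D : (forall x y, x < y < x + N -> dl D x y <-> arcW x y \/ arcW y (x + N)) ->
  core D (face a p).
Proof.
move=> hD; have hab := face_arc_range; have Lab := face_arc.
split; first by rewrite card_face.
  move=> x z y w hz hw Dxy Fz Fw; case: (proj1 (hD x y ltac:(lia)) Dxy) => Lxy.
    by move: (face_uncut_arc Lxy hz hw Fz); rewrite Fw.
  rewrite -(vtxDN _ z) in Fz.
  by move: (face_uncut_arc Lxy hw (ltac:(lia) : x + N < z + N < y + N) Fw); rewrite Fz.
move=> x0 y0 hxy0 Fx Fy hno.
have [x hx Ex] := vtx_lift a (vtx n x0); pose y := x + (y0 - x0).
have Ey : vtx n y = vtx n y0 by rewrite /y (vtx_congr _ Ex) subnKC //; lia.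
have {}hno z : x < z < y -> vtx n z \notin face a p.
  move=> hz; have := hno (x0 + (z - x)) ltac:(lia).
  by rewrite -(vtx_congr _ Ex) subnKC //; lia.
suff : y = x.+1 \/ dl D x y.
  by rewrite /dl Ex Ey; case=> [h|]; [left; lia|right].
rewrite -Ex in Fx; rewrite -Ey in Fy.
have hxy : x < y < x + N by lia.
have fx := on_face_vtx hx Fx.
have next z : on_face z -> x < z -> y <= z.
  move=> fz xz; rewrite leqNgt; apply/negP => zy.
  by have := hno z (ltac:(lia)); rewrite face_vtx.
have lt := tail_sum_lt (ltnSn p) hp.
case: (fx) => [Exa|[rx hxx]].
  pose z := hit a (sig a p.+1).
  have fz : on_face z by apply: on_face_hit; lia.
  have /recP [az _] := hit_rec a (sig a p.+1).
  have yz : y <= z by apply: next => //; rewrite Exa.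
  have Eyz : y = z.
    have := on_face_range fz => hz.
    case: (on_face_vtx _ Fy) => [||[ry hy]]; try lia.
    have := rec_lt ry (hit_rec a (sig a p.+1)); rewrite hit_height -/z; lia.
  case: (ltnP p.+1 (size (W a))) => hps; last first.
    by left; rewrite Eyz /z tail_sum_size // hit0 Exa.
  right; apply/hD => //; left; rewrite Eyz Exa; exact: arcW_hit.
case: (ltrP (H x) (H a.+1 + (sig a p)%:Z)) => hxs.
  pose k := `|H x - H a.+1|%N; pose z := hit a k.+1.
  have Hz : H z = (H x + 1)%R by rewrite /z hit_height; lia.
  have fz : on_face z by apply: on_face_hit; lia.
  have xz : x < z by rewrite (rec_lt rx (hit_rec _ _)) Hz; lia.
  have yz := next _ fz xz; have := on_face_range fz => hz.
  case: (on_face_vtx _ Fy) => [||[ry hy]]; try lia.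
  have Eyz : y = z.
    have := rec_lt rx ry; have := rec_lt ry (hit_rec a k.+1); rewrite -/z Hz; lia.
  case: (ltngtP x.+1 y) => [xy|xy|->]; [|lia|by left].
  right; apply/hD => //; left.
  have /recP [ay hry] := ry.
  have Hy : H y = (H x + 1)%R by rewrite Eyz.
  have sx : 0 < size (W x).
    rewrite lt0n; apply/eqP => /size0nil Wx; have := heightS x; rewrite Wx /= => Hx.
    by have := hry x.+1; lia.
  apply/arcWP; exists 0; split=> //; last by rewrite tail_sum0 heightS; lia.
  by apply/recP; split=> [|t ht]; [lia|apply: hry; lia].
have Exb : x = b by apply: rec_inj rx (hit_rec _ _) _; rewrite hit_height; lia.
have yN : y <= a + N.
  rewrite leqNgt; apply/negP => h; have := hno (a + N) ltac:(lia).
  by rewrite vtxDN face_vtx //; left.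
have Ey' : y = a + N.
  case: (ltngtP y (a + N)) => [h|h|->//]; last lia.
  by have := on_face_range (on_face_vtx (ltac:(lia) : a <= y < a + N) Fy); lia.
right; rewrite Ey' dlDNr dlC Exb; apply/hD; [lia|by left].
Qed.

End Face.

Hypothesis arcW_bound : forall a b, arcW a b -> b <= a + n.
Local Notation D := (chords n arcW).

Let dD : dissection D.
Proof. exact: chords_dissection arcW_sys arcW_bound. Qed.

Let dlD x y (h : x < y < x + N) : dl D x y <-> arcW x y \/ arcW y (x + N).
Proof. exact: (dl_chords arcW_sys h). Qed.

Lemma face_subgon a p : N <= a -> p < size (W a) -> subgon D (face a p).
Proof.
move=> aN hp; apply/subgonP => //; split; last exact: face_core.
by rewrite card_face // !ltnS letter_pos.
Qed.

Lemma outer_core_word : core D (outer n arcW).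
Proof. exact: (outer_core arcW_sys dlD). Qed.

(** A subgon made of outer vertices is the outer face by [core_sub]. For any other, take a shortest
    arc strictly over one of its vertices. Every vertex strictly under that arc is a record from [a]
    at a height of the face, since otherwise a shorter arc would lie over it. *)
Lemma subgon_cases S : subgon D S ->
  S = outer n arcW \/ exists a p, [/\ N <= a < N + N, p < size (W a) & S = face a p].
Proof.
move=> gS; have [S3 [_ unc _]] := proj1 (subgonP S dD) gS; have [range per cross] := arcW_sys.
case: (boolP (S \subset outer n arcW)) => [sub|/subsetPn [i Si nfi]].
  left; apply/eqP; rewrite eqEsubset sub (core_sub dD) //.
  - by case: (proj1 (subgonP S dD) gS).
  - by case: outer_core_word.
  - by move/setIidPl: sub => ->.
right; pose P k := [exists x : 'I_N, arcW (x + N) (x + N + k) &&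
  has (fun z => vtx n z \in S) (iota (x + N).+1 k.-1)].
have PI a b z : arcW a b -> a < z < b -> vtx n z \in S -> P (b - a).
  move=> Lab hz Sz; have hab := range _ _ Lab.
  have E : vtx n (vtx n a + N) = vtx n a by rewrite vtxDN vtx_val.
  apply/existsP; exists (vtx n a); apply/andP; split.
    by rewrite (arc_congr arcW_sys _ E) subnKC //; lia.
  apply/hasP; exists (vtx n a + N + (z - a)); first by rewrite mem_iota; lia.
  by rewrite (vtx_congr _ E) subnKC //; lia.
have exP : exists k, P k.
  have [z hz Ez] := vtx_lift N i; subst i.
  move: nfi; rewrite (mem_outer arcW_sys) ?negbK; last lia.
  by case/(coveredP arcW_sys) => a [b [Lab hab]]; exists (b - a); apply: PI Lab hab Si.
case: (ex_minnP exP) => k /existsP [x /andP [Lab /hasP [z]]]; rewrite mem_iota => hz Sz mink.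
pose a := x + N; rewrite -/a in Lab hz.
have {}mink u v y : arcW u v -> u < y < v -> vtx n y \in S -> k <= v - u.
  by move=> h1 h2 h3; apply: mink; apply: PI h1 h2 h3.
have ha : N <= a < N + N by rewrite /a; have := ltn_ord x; lia.
clearbody a; clear P PI exP x i Si nfi.
have {z hz Sz} [z [hz Sz]] : exists z : nat, a < z < a + k /\ vtx n z \in S.
  by exists z; split=> //; lia.
have /arcWP [p [hp hr Hk]] := Lab; exists a, p; split=> //.
have Eb : a + k = hit a (sig a p) by apply: rec_inj hr (hit_rec _ _) _; rewrite hit_height.
have hab := range _ _ Lab.
apply: (subgon_eq dD) => //; first by apply: face_subgon; lia.
suff /setIidPl -> : S \subset face a p by [].
apply/subsetP => j Sj; have [y hy Ey] := vtx_lift a j; subst j.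
apply: face_vtx => //.
have yb : y <= a + k.
  by rewrite leqNgt; apply/negP => hby; apply: (unc a z (a + k) y) => //; [lia|apply/dlD; [lia|by left]].
case: (ltngtP a y) => [ay||->]; [|lia|by left].
case: (ltngtP y (a + k)) => [lt||->]; [|lia|by rewrite Eb; apply: on_face_end].
have rz : rec a y.
  apply/recP; split=> // t ht; rewrite ltNge; apply/negP => hle.
  have [|u [v [tu [Luv huv]]]] := @arcW_over t y _ hle; first lia.
  by have := mink _ _ _ Luv huv Sj; have := cross _ _ _ _ Lab Luv; lia.
right; split=> //; have /recP [_ hr'] := hr.
have := hr' y; rewrite Hk => /(_ ltac:(lia)) hlt.
case: (lerP (H a.+1 + (sig a p.+1)%:Z) (H y)) => h; first lia.
have hps : p.+1 < size (W a).
  by rewrite ltnNge; apply/negP => /tail_sum_size E; have := rec_height rz; rewrite E in h; lia.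
have := mink a (hit a (sig a p.+1)) y (arcW_hit hps).
have ltp := tail_sum_lt (ltnSn p) hp.
have : y < hit a (sig a p.+1) by rewrite (rec_lt rz (hit_rec _ _)) hit_height.
have : hit a (sig a p.+1) < a + k by rewrite (rec_lt (hit_rec _ _) hr) hit_height Hk; lia.
by move=> h1 h2 h3; have := h3 ltac:(lia) Sj; lia.
Qed.

Lemma face_neq_outer a p : N <= a -> p < size (W a) -> face a p <> outer n arcW.
Proof.
move=> aN hp; have [z hz fz] := face_inner hp => E.
have := outer_arc arcW_sys (face_arc hp) hz.
by rewrite -E face_vtx.
Qed.

(** Faces with different starts that contain each other's start have base arcs that cross, up to a
    full turn. With the same start, the end of the longer base arc is too high for the other
    face. *)
Lemma face_inj a p a' p' : N <= a < N + N -> N <= a' < N + N ->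
  p < size (W a) -> p' < size (W a') -> face a p = face a' p' -> (a, p) = (a', p').
Proof.
wlog le_aa : a a' p p' / a <= a' => [IH ha ha' hp hp' E|].
  case: (leqP a a') => [h|/ltnW h]; first exact: (IH _ _ _ _ h ha ha' hp hp' E).
  by apply/esym; exact: (IH _ _ _ _ h ha' ha hp' hp (esym E)).
move=> ha ha' hp hp' E; have [range per cross] := arcW_sys.
have Fa : vtx n a \in face a' p' by rewrite -E face_vtx //; left.
have Fa' : vtx n a' \in face a p by rewrite E face_vtx //; left.
have hab := face_arc_range hp; have hab' := face_arc_range hp'.
case: (ltngtP a a') => [lt_aa|lt_aa|Eaa]; [|lia|].
  have hb := on_face_range hp (on_face_vtx hp (ltac:(lia) : a <= a' < a + N) Fa').
  rewrite -vtxDN in Fa.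
  have hb' := on_face_range hp' (on_face_vtx hp' (ltac:(lia) : a' <= a + N < a' + N) Fa).
  case: (ltngtP a' (hit a (sig a p))) => [h|h|Eb]; [|lia|].
    by have := cross _ _ _ _ (face_arc hp) (face_arc hp') (ltac:(lia)); lia.
  have [z hz fz] := face_inner hp; have Fz := face_vtx hp fz.
  rewrite E -vtxDN in Fz.
  have hz' := on_face_range hp' (on_face_vtx hp' (ltac:(lia) : a' <= z + N < a' + N) Fz).
  have := face_arc hp; rewrite -per => Lab.
  by have := cross _ _ _ _ (face_arc hp') Lab (ltac:(lia)); lia.
subst a'; congr pair.
have key q q' : q < size (W a) -> q' < size (W a) -> q < q' -> face a q = face a q' -> False.
  move=> hq hq' lt_qq Eq; have := tail_sum_lt lt_qq hq; have := face_arc_range hq.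
  have Fb := face_vtx hq (on_face_end hq); rewrite Eq in Fb.
  move=> hb; case: (on_face_vtx hq' (ltac:(lia) : a <= hit a (sig a q) < a + N) Fb).
    by lia.
  by case=> _; rewrite hit_height; lia.
by case: (ltngtP p p') => // h; exfalso; [apply: key h E | apply: key h (esym E)].
Qed.

Lemma card_subgons_word i : 0 < i ->
  #|[set S in subgons D | #|S| == i.+2]| =
    (c == i.+2) + \sum_(N <= a < N + N) count_mem i (W a).
Proof.
move=> i0; pose idx := [seq (a, p) | a <- iota N N, p <- iota 0 (size (W a))].
pose fs := [seq face q.1 q.2 | q <- idx & nth 0 (W q.1) q.2 == i].
have idxP q : q \in idx -> N <= q.1 < N + N /\ q.2 < size (W q.1).
  by case/allpairsPdep => a [p]; rewrite !mem_iota => - [ha hp ->] /=; lia.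
have ufs : uniq fs.
  rewrite map_inj_in_uniq; last first.
    move=> [a p] [a' p']; rewrite !mem_filter => /andP [_ /idxP /= [h1 h2]].
    by move=> /andP [_ /idxP /= [h3 h4]] /face_inj; apply.
  rewrite filter_uniq // allpairs_uniq_dep ?iota_uniq // => [a _|]; first exact: iota_uniq.
  by move=> [a p] [a' p'] _ _ [-> ->].
have nout : outer n arcW \notin fs.
  apply/mapP => [] [[a p]]; rewrite mem_filter => /andP [_ /idxP /= [h1 h2]] /esym.
  by apply: face_neq_outer; lia.
have sz : size fs = \sum_(N <= a < N + N) count_mem i (W a).
  rewrite size_map size_filter count_flatten -map_comp sumnE big_map /index_iota addKn.
  apply: eq_bigr => a _; rewrite /= count_map -{2}[W a](mkseq_nth 0) count_map.
  by apply: eq_count => p.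
rewrite -sz; have -> : [set S in subgons D | #|S| == i.+2] =
    [set:: (if c == i.+2 then [:: outer n arcW] else [::]) ++ fs].
  apply/setP => S; rewrite [LHS]inE [RHS]inE mem_cat [S \in subgons _]inE.
  apply/andP/orP => [[gS /eqP cS]|].
    case: (subgon_cases gS) => [E|[a [p [ha hp E]]]].
      by left; rewrite -cS E card_outer_word eqxx mem_head.
    right; apply/mapP; exists (a, p) => //; rewrite mem_filter /=; apply/andP; split.
      by move: cS; rewrite E card_face // => -[->].
    by apply/allpairsPdep; exists a, p; rewrite !mem_iota.
  case=> [|/mapP [[a p]]].
    case: eqP => // E; rewrite inE => /eqP ->; rewrite card_outer_word E eqxx; split=> //.
    by apply/subgonP => //; split; [rewrite card_outer_word E | exact: outer_core_word].
  rewrite mem_filter /= => /andP [/eqP E /idxP /= [ha hp]] ->.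
  by rewrite card_face // E eqxx face_subgon //; lia.
rewrite cardsE; have /card_uniqP -> : uniq ((if c == i.+2 then [:: outer n arcW] else [::]) ++ fs).
  by case: eqP => _ //=; rewrite nout ufs.
by rewrite size_cat; case: eqP.
Qed.

(** An invariant diagonal is a diameter, and then both its directions are arcs, so no other vertex
    is outer. For an invariant face with a base arc, that arc would cross a translate of itself or
    be crossed by one. *)
Lemma fixed_core_unique m S : 0 < m < N -> (forall t, W (t + m) = W t) ->
  (forall z, (vtx n (z + m) \in S) = (vtx n z \in S)) ->
  (S \in D) || subgon D S -> S = outer n arcW.
Proof.
move=> hm Wm perS; have [range per cross] := arcW_sys.
have perm := arcW_shift Wm (height_shift Wm).
case/orP=> [SD|/subgon_cases [//|[a [p [ha hp E]]]]].
  have /(chordsP arcW_sys) [a [b [Lab E]]] := SD; have hab := range _ _ Lab.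
  have /orP [/eqP h|/eqP /(@vtx_inj n a) h] : (vtx n (a + m) == vtx n a) || (vtx n (a + m) == vtx n b).
    by rewrite -in_set2 -E perS E !inE eqxx.
    by move: h => /(@vtx_inj n a); lia.
  have {h} Eb : a + m = b by apply: h; lia.
  have /orP [/eqP h|/eqP h] : (vtx n (b + m) == vtx n a) || (vtx n (b + m) == vtx n b).
  - by rewrite -in_set2 -E perS E !inE eqxx orbT.
  - have EN : b + m = a + N.
      by apply: (@vtx_inj n b); rewrite ?vtxDN //; lia.
    have Lba : arcW b (a + N) by rewrite -EN -Eb perm Eb.
    apply/esym/eqP; rewrite eqEcard; apply/andP; split.
      apply/subsetP => i fi; have [z hz Ez] := vtx_lift a i; subst i; rewrite E in_set2.
      case: (ltngtP a z) => [az||->]; [|lia|by rewrite eqxx].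
      case: (ltngtP z b) => [zb|bz|->]; last by rewrite eqxx orbT.
        by move: fi; rewrite (negPf (outer_arc arcW_sys Lab _)) // az.
      by move: fi; rewrite (negPf (outer_arc arcW_sys Lba _)) // bz; lia.
    rewrite E cards2; have := card_outer arcW_sys; by case: (_ == _); lia.
  - by move: h => /(@vtx_inj n b); lia.
subst S; have hab := face_arc_range hp; set b := hit _ _ in hab.
have Lab : arcW a b := face_arc hp.
have Lab' : arcW (a + m) (b + m) by rewrite perm.
have Fm z : on_face a p z -> a <= z + m <= b \/ a + N <= z + m <= b + N.
  move=> fz; have := on_face_range hp fz => hz; have := face_vtx hp fz; rewrite -perS => Fz.
  case: (ltnP (z + m) (a + N)) => h.
    by left; apply: on_face_range; rewrite // -/b; apply: on_face_vtx => //; lia.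
  right; rewrite -(subnK (ltac:(lia) : N <= z + m)) vtxDN in Fz.
  have := on_face_range hp (on_face_vtx hp (ltac:(lia) : a <= z + m - N < a + N) Fz).
  by rewrite -/b; lia.
have fa : on_face a p a by left.
have [z hz fz] := face_inner hp; have fb := on_face_end hp.
(* The image of [a] forces [a + m = b], because the arc and its translate do not cross. The image of
   the inner vertex [z] then puts [a + N] strictly under the translate, which the arc from [a + N]
   leaves. *)
have := Fm _ fa; have := Fm _ fz; have := Fm _ fb; rewrite -/b in hz *.
have := cross _ _ _ _ Lab Lab'; have := perm a b.
have := Lab; rewrite -(per) => LabN; have := cross _ _ _ _ Lab' LabN.
lia.
Qed.

End Word.

(** * From arc systems to words *)

(** Recovers letters from their tail sums; the default [0] makes the last tail sum its own
    letter. *)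
Fixpoint diffs (s : seq nat) : seq nat :=
  if s is x :: s' then (x - head 0 s') :: diffs s' else [::].

Lemma size_diffs s : size (diffs s) = size s.
Proof. by elim: s => //= x s ->. Qed.

Lemma sumn_diffs s : sorted (fun x y => y <= x) s -> sumn (diffs s) = head 0 s.
Proof.
elim: s => //= x [|y s] IH /=; first by rewrite subn0 addn0.
by case/andP => yx hs; have /= -> := IH hs; rewrite subnK.
Qed.

Lemma drop_diffs k s : drop k (diffs s) = diffs (drop k s).
Proof. by elim: k s => [|k IH] [|x s] //=. Qed.

Lemma diffs_pos s : sorted (fun x y => y < x) s -> all (ltn 0) s -> all (ltn 0) (diffs s).
Proof.
elim: s => //= x [|y s] IH /=; first by rewrite subn0.
by case/andP=> yx hs /andP [_ h]; rewrite subn_gt0 yx /=; apply: IH.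
Qed.

Lemma sum_nat_support (f : nat -> nat) lo hi lo' hi' :
  (forall z, f z != 0 -> lo <= z < hi) -> (forall z, f z != 0 -> lo' <= z < hi') ->
  \sum_(lo <= z < hi) f z = \sum_(lo' <= z < hi') f z.
Proof.
move=> h h'.
have widen l u M : (forall z, f z != 0 -> l <= z < u) -> u <= M ->
    \sum_(l <= z < u) f z = \sum_(0 <= z < M) f z.
  move=> hf uM; rewrite (big_nat_widenl l 0) // (big_nat_widen 0 u M) // big_mkcond.
  apply: eq_bigr => z _; case: ifP => // /negbT; case: (eqVneq (f z) 0) => // /hf.
  by rewrite /=; lia.
by rewrite (widen _ _ (maxn hi hi')) ?leq_maxl // (widen lo' _ (maxn hi hi')) ?leq_maxr.
Qed.

Lemma sum_nat_bool_le (f : nat -> bool) lo hi : \sum_(lo <= z < hi) f z <= hi - lo.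
Proof.
rewrite -[hi - lo]muln1 -sum_nat_const_nat; apply: leq_sum => z _; exact: leq_b1.
Qed.

Section Children.
Variables (n : nat) (L : nat -> nat -> bool).
Local Notation N := n.+2.
Implicit Types (a b x y z t : nat).
Hypothesis sysL : arcsys n L.

Let rangeL a b : L a b -> a.+1 < b < a + N.
Proof. by case: sysL => h _ _; apply: h. Qed.
Let crossL a x b y : L a b -> L x y -> a < x < b -> y <= b.
Proof. by case: sysL => _ _; apply. Qed.

Definition over x z := (x < z) && has (L x) (iota z.+1 N).

Lemma overP x z : reflect (exists2 y, L x y & x < z < y) (over x z).
Proof.
apply: (iffP andP) => [[h1 /hasP [y hy Lxy]]|[y Lxy h]].
  by exists y => //; move: hy; rewrite mem_iota; lia.
split; first lia; apply/hasP; exists y => //; rewrite mem_iota.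
by have := rangeL Lxy; lia.
Qed.

(* [child x z]: the innermost arc strictly over [z] starts at [x]. *)
Definition child x z := over x z && all (fun t => ~~ over t z) (iota x.+1 (z - x.+1)).

Lemma childP x z : reflect (over x z /\ forall t, x < t < z -> ~~ over t z) (child x z).
Proof.
apply: (iffP andP) => [] [h1 h2]; split=> //.
  by move=> t ht; apply: (allP h2); rewrite mem_iota; lia.
by apply/allP => t; rewrite mem_iota => ht; apply: h2; lia.
Qed.

Lemma child_lt x z : child x z -> x < z.
Proof. by case/childP => /overP [y _]; lia. Qed.

Lemma child_exists a z : over a z -> exists2 x, a <= x < z & child x z.
Proof.
move=> oaz; have ex : exists x, over x z by exists a.
have ub x : over x z -> x <= z by case/overP => y _; lia.
case: (ex_maxnP ex ub) => x oxz maxx; exists x.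
  by have := maxx _ oaz; case/overP: oxz => y _; lia.
apply/childP; split=> // t ht; apply/negP => /maxx; lia.
Qed.

Lemma child_inj x y z : child x z -> child y z -> x = y.
Proof.
move=> /[dup] /child_lt hx /childP [ox ux] /[dup] /child_lt hy /childP [oy uy].
case: (ltngtP x y) => // h.
  by have := ux y; rewrite oy h hy => /(_ isT).
by have := uy x; rewrite ox h hx => /(_ isT).
Qed.

Lemma sum_child_le1 a b z : \sum_(a <= x < b) child x z <= 1.
Proof.
elim: b => [|b IH]; first by rewrite big_geq.
case: (leqP a b) => ab; last by rewrite big_geq.
rewrite big_nat_recr //=; case: (boolP (child b z)) => cb; last by rewrite addn0.
rewrite big_nat big1 // => x hx; apply/eqP; rewrite eqb0; apply/negP => cx.
by have := child_inj cx cb; lia.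
Qed.

Lemma sum_child1 a b z : over a z -> z <= b -> \sum_(a <= x < b) child x z = 1.
Proof.
move=> oaz zb; apply/eqP; rewrite eqn_leq sum_child_le1 /=.
have [x hx cx] := child_exists oaz.
rewrite (big_cat_nat _ (n := x)) /=; try lia.
by rewrite [X in _ + X]big_ltn ?cx; lia.
Qed.

Lemma child_in_arc a b x z : L a b -> a < x < b -> child x z -> x < z < b.
Proof.
move=> Lab hx /childP [/overP [y Lxy hz] _].
by have := crossL Lab Lxy hx; lia.
Qed.

(** These vertices are the ones counted by the letters at [x]. The variant [span a b] keeps those
    under the arc from [a] to [b], and will be the tail sum at the letter of that arc. *)
Definition children x := \sum_(x.+1 <= z < x + N) child x z.
Definition span a b := \sum_(a.+1 <= z < b) child a z.

Lemma child_range x z : child x z -> x < z < x + N.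
Proof. by case/childP => /overP [y /rangeL]; lia. Qed.

Lemma children_in_arc a b x : L a b -> a < x < b -> children x = \sum_(a.+1 <= z < b) child x z.
Proof.
move=> Lab hx; apply: sum_nat_support => z; rewrite eqb0 negbK => cz.
  exact: child_range.
by have := child_in_arc Lab hx cz; lia.
Qed.

(** The reversal lists longer arcs first, in the order of the letters. *)
Definition arc_ends a := rev [seq b <- iota a.+1 N | L a b].

Lemma mem_arc_ends a b : (b \in arc_ends a) = L a b.
Proof.
rewrite mem_rev mem_filter andb_idr // => /rangeL; rewrite mem_iota; lia.
Qed.

(* The end of a shorter arc from [a] is a child of [a] under any longer one. *)
Lemma span_lt a b b' : L a b -> L a b' -> b < b' -> span a b < span a b'.
Proof.
move=> Lab Lab' bb; have hab := rangeL Lab; rewrite /span [X in _ < X](big_cat_nat _ (n := b)) /=; try lia.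
suff cb : child a b by rewrite [X in _ + X]big_ltn // cb; lia.
apply/childP; split; first by apply/overP; exists b' => //; lia.
by move=> t ht; apply/negP => /overP [y Lty hy]; have := crossL Lab Lty; lia.
Qed.

Lemma span_pos a b : L a b -> 0 < span a b.
Proof.
move=> Lab; have hab := rangeL Lab; rewrite /span big_ltn; last lia.
suff -> : child a a.+1 by lia.
by apply/childP; split=> [|t]; [apply/overP; exists b => //; lia | lia].
Qed.

Definition word a := diffs [seq span a b | b <- arc_ends a].

Lemma sorted_spans a : sorted (fun x y => y < x) [seq span a b | b <- arc_ends a].
Proof.
rewrite sorted_map; have : sorted (fun x y => y < x) (arc_ends a).
  by rewrite rev_sorted sorted_filter ?iota_ltn_sorted //; exact: ltn_trans.
move=> h; apply: (@sub_in_sorted _ [pred b | L a b] (fun x y => y < x)) h.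
  by move=> x y /= Lx Ly xy; apply: span_lt.
by apply/allP => b; rewrite mem_arc_ends.
Qed.

Lemma sorted_spans_le a : sorted (fun x y => y <= x) [seq span a b | b <- arc_ends a].
Proof. by apply: sub_sorted (sorted_spans a) => x y /=; exact: ltnW. Qed.

Lemma word_pos a : all (ltn 0) (word a).
Proof.
apply: diffs_pos (sorted_spans a) _; apply/allP => _ /mapP [b hb ->].
by apply: span_pos; rewrite -mem_arc_ends.
Qed.

Lemma size_word a : size (word a) = size (arc_ends a).
Proof. by rewrite size_diffs size_map. Qed.

Lemma tail_sum_word a p : p < size (word a) ->
  tail_sum word a p = span a (nth 0 (arc_ends a) p).
Proof.
rewrite size_word => hp; rewrite /tail_sum drop_diffs sumn_diffs.
  by rewrite -map_drop (drop_nth 0 hp).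
by apply: drop_sorted; apply: sorted_spans_le.
Qed.

Lemma sumn_word a : sumn (word a) = children a.
Proof.
rewrite sumn_diffs ?sorted_spans_le //; case E : (arc_ends a) => [|b s] /=.
  rewrite /children big1 // => z _; apply/eqP; rewrite eqb0; apply/negP.
  by case/childP => /overP [y]; rewrite -mem_arc_ends E.
have Lab : L a b by rewrite -mem_arc_ends E mem_head.
apply: sum_nat_support => z; rewrite eqb0 negbK => cz; last exact: child_range.
have /childP [/overP [y Lay hz] _] := cz; apply/andP; split; first lia.
suff : y <= b by lia.
have : sorted (fun x y => y < x) (arc_ends a).
  by rewrite rev_sorted sorted_filter ?iota_ltn_sorted //; exact: ltn_trans.
have : y \in arc_ends a by rewrite mem_arc_ends.
rewrite E inE => /orP [/eqP -> //|ys] /=; rewrite (path_sortedE (rev_trans ltn_trans)).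
by case/andP => /allP /(_ _ ys) /ltnW.
Qed.

Local Notation H := (height word).

Lemma height_diff a b : a <= b -> (H b - H a)%R = ((b - a)%:Z - (\sum_(a <= x < b) children x)%:Z)%R.
Proof.
move=> ab; rewrite /height; under eq_bigr do rewrite sumn_word.
under [in X in (_ - X)%R]eq_bigr do rewrite sumn_word.
by rewrite (big_cat_nat _ (n := a)) //=; lia.
Qed.

(** Double counting: each of the [b - a.+1] positions under the arc is the child of exactly one
    start in [[a, b)]. The starts other than [a] account for the letters read, and the children of
    [a] make up the rise. *)
Lemma height_arc a b : L a b -> H b = (H a.+1 + (span a b)%:Z)%R.
Proof.
move=> Lab; have hab := rangeL Lab.
suff E : \sum_(a.+1 <= x < b) children x + span a b = b - a.+1.
  by have := @height_diff a.+1 b; lia.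
have -> : \sum_(a.+1 <= x < b) children x = \sum_(a.+1 <= x < b) \sum_(a.+1 <= z < b) child x z.
  by apply: eq_big_nat => x hx; apply: children_in_arc Lab _; lia.
rewrite exchange_big /= addnC /span -big_split /= -[RHS]muln1 -sum_nat_const_nat.
apply: eq_big_nat => z hz; rewrite -[RHS](@sum_child1 a b z) ?[RHS]big_ltn //; try lia.
by apply/overP; exists b => //; lia.
Qed.

(** The same count stopped at [t]: the [t - a] positions after [a] up to [t] all have their parent
    before [t], one more than the up-steps made since [a.+1]. *)
Lemma height_below_arc a b t : L a b -> a < t < b -> (H t < H b)%R.
Proof.
move=> Lab ht; rewrite (height_arc Lab).
suff : t - a.+1 < \sum_(a.+1 <= x < t) children x + span a b.
  by have := @height_diff a.+1 t; lia.
have -> : \sum_(a.+1 <= x < t) children x = \sum_(a.+1 <= x < t) \sum_(a.+1 <= z < b) child x z.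
  by apply: eq_big_nat => x hx; apply: children_in_arc Lab _; lia.
rewrite exchange_big /= addnC /span -big_split /=.
have E z : a < z <= t -> child a z + \sum_(a.+1 <= x < t) child x z = 1.
  move=> hz; rewrite -[RHS](@sum_child1 a t z) ?[RHS]big_ltn //; try lia.
  by apply/overP; exists b => //; lia.
rewrite (big_cat_nat _ (n := t.+1)) /=; try lia.
rewrite (eq_big_nat _ _ (F2 := fun=> 1)); last by move=> z hz; apply: E; lia.
by rewrite sum_nat_const_nat muln1; lia.
Qed.

Lemma arcW_word a b : arcW word a b = L a b.
Proof.
have rec_arc y : L a y -> rec word a y.
  move=> Lay; apply/recP; split=> [|t ht]; first by have := rangeL Lay; lia.
  exact: height_below_arc Lay ht.
apply/arcWP/idP => [[p [hp hr E]]|Lab].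
  rewrite tail_sum_word // in E.
  have Ly : L a (nth 0 (arc_ends a) p) by rewrite -mem_arc_ends mem_nth // -size_word.
  by rewrite (rec_inj hr (rec_arc _ Ly)) // E (height_arc Ly).
exists (index b (arc_ends a)).
have hi : index b (arc_ends a) < size (word a) by rewrite size_word index_mem mem_arc_ends.
split=> //; first exact: rec_arc.
by rewrite tail_sum_word // nth_index ?mem_arc_ends; first exact: height_arc.
Qed.

Section Shift.
Variable m : nat.
Hypothesis perm : forall a b, L (a + m) (b + m) = L a b.

Lemma over_shift x z : over (x + m) (z + m) = over x z.
Proof.
apply/overP/overP => [] [y Lxy h].
  by exists (y - m); last lia; rewrite -perm subnK //; lia.
by exists (y + m); rewrite ?perm; last lia.
Qed.

Lemma child_shift x z : child (x + m) (z + m) = child x z.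
Proof.
apply/childP/childP => [] []; rewrite over_shift => h1 h2; split=> // t ht.
  by rewrite -over_shift; apply: h2; lia.
by have := h2 (t - m); rewrite -over_shift subnK; [apply|]; lia.
Qed.

Lemma span_shift a b : span (a + m) (b + m) = span a b.
Proof.
rewrite /span -addSn big_addn addnK; apply: eq_bigr => z _.
by rewrite child_shift.
Qed.

Lemma word_shift a : word (a + m) = word a.
Proof.
congr diffs; rewrite /arc_ends !map_rev; congr rev.
rewrite -addSn [a.+1 + m]addnC iotaDl filter_map -map_comp.
rewrite (eq_filter (a2 := L a)) => [|b /=]; last by rewrite [m + b]addnC perm.
by apply: eq_map => b /=; rewrite [m + b]addnC span_shift.
Qed.
End Shift.

Lemma sum_periodic (f : nat -> nat) m t : (forall x, f (x + m) = f x) ->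
  \sum_(t <= x < t + m) f x = \sum_(0 <= x < m) f x.
Proof.
move=> fm; elim: t => [|t IH]; first by rewrite add0n.
case: m fm IH => [|m] fm IH; first by rewrite !big_geq // addn0.
rewrite -IH addSn big_nat_recr /=; last lia.
by rewrite fm addnC -big_ltn //; lia.
Qed.

(** Every position has at most one parent, and at least two outer vertices per turn have none. The
    window starts at an outer [x], so no arc straddles its end. *)
Lemma children_total : \sum_(0 <= x < N) children x <= n.
Proof.
have [_ perN _] := sysL.
have chN x : children (x + N) = children x by rewrite -!sumn_word word_shift.
have /card_gt1P [i [j [fi fj nij]]] := card_outer sysL.
have [x hx Ex] := vtx_lift (N + N) i; have [y hy Ey] := vtx_lift x j; subst i j.
have xy : x < y by case: (ltngtP x y) nij => [||->] //; [lia|rewrite eqxx].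
rewrite (mem_outer sysL) in fi; last lia; rewrite (mem_outer sysL) in fj; last lia.
rewrite -(sum_periodic x chN).
have -> : \sum_(x <= t < x + N) children t = \sum_(x <= t < x + N) \sum_(x <= z < x + N) child t z.
  apply: eq_big_nat => t ht; apply: sum_nat_support => z; rewrite eqb0 negbK => cz.
    exact: child_range.
  have := child_lt cz; case: (ltnP z (x + N)) => hz; first lia.
  case/childP: cz => /overP [u Ltu hu] _; move: fi; rewrite -(coveredDN sysL); last lia.
  by case/(coveredP sysL); exists t, u; split=> //; lia.
rewrite exchange_big /=.
have le z : \sum_(x <= t < x + N) child t z <= covered n L z.
  case: (boolP (covered n L z)) => cz; first exact: sum_child_le1.
  rewrite leqn0 big1 // => t _; apply/eqP; rewrite eqb0; apply/negP => /childP [] /overP [u Ltu hu] _.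
  by case/(coveredP sysL): cz; exists t, u.
apply: leq_trans (leq_sum _ (fun z _ => le z)) _.
rewrite big_ltn ?(negPf fi) /=; last lia.
rewrite (big_cat_nat _ (n := y)) /=; try lia.
rewrite [X in _ + (_ + X)]big_ltn ?(negPf fj) /=; last lia.
have := sum_nat_bool_le (covered n L) x.+1 y.
by have := sum_nat_bool_le (covered n L) y.+1 (x + N); lia.
Qed.
End Children.

(** * Rotations and invariant cores *)

Section Rotation.
Variable n : nat.
Local Notation N := n.+2.
Implicit Types (a b x y z t : nat) (D : {set {set 'I_N}}) (S : {set 'I_N}).

Definition shift_inv (f : nat -> nat -> bool) m := forall a b, f (a + m) (b + m) = f a b.

Lemma shift_inv_mul f m k : shift_inv f m -> shift_inv f (k * m).
Proof.
move=> hf; elim: k => [|k IH] a b; first by rewrite !addn0.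
by rewrite mulSn [m + _]addnC !addnA hf IH.
Qed.

Lemma shift_inv_gcd f j m : 0 < m -> shift_inv f m -> shift_inv f (gcdn j m) <-> shift_inv f j.
Proof.
move=> m0 fm; split=> [fg|fj].
  by have /dvdnP [k ->] := dvdn_gcdl j m; apply: shift_inv_mul.
(* Bezout without subtraction, [km * m = kn * j + gcdn m j]: a further shift by [kn * j] completes
   the gcd to a multiple of [m]. *)
rewrite gcdnC => a b; case: (egcdnP j m0) => km kn E _.
rewrite -(shift_inv_mul kn fj) -!addnA [gcdn m j + _]addnC -E.
exact: shift_inv_mul.
Qed.

Lemma ord_pred_vtx a : ord_pred (vtx n a.+1) = vtx n a.
Proof.
apply/val_inj; rewrite /= -addn1 -modnDml.
have := ltn_pmod a (isT : 0 < N); move: (a %% N) => r hr.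
case: (ltngtP r.+1 N) => h; [|lia|].
  by rewrite (modn_small (m := r + 1)); [have -> : (r + 1 + N).-1 = r + N by lia|lia];
    rewrite modnDr modn_small.
have -> : r + 1 = N by lia.
by rewrite modnn add0n modn_small; lia.
Qed.

Lemma ord_pred_inj : injective (@ord_pred N).
Proof.
have Es (k : 'I_N) : vtx n (k + n.+1).+1 = k by rewrite -addnS vtxDN vtx_val.
move=> i j E; have : vtx n (i + n.+1) = vtx n (j + n.+1) by rewrite -(ord_pred_vtx (i + _)) -(ord_pred_vtx (j + _)) !Es.
by move/(vtx_congr 1); rewrite !addn1 !Es.
Qed.

Lemma dl_rot D a b : dl (rot_dissection D) a b = dl D a.+1 b.+1.
Proof.
rewrite /dl /rot_dissection -(ord_pred_vtx a) -(ord_pred_vtx b).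
have -> : [set ord_pred (vtx n a.+1); ord_pred (vtx n b.+1)] =
    [set ord_pred x | x in [set vtx n a.+1; vtx n b.+1]] by rewrite imsetU1 imset_set1.
apply: (mem_imset (f := fun e : {set 'I_N} => [set ord_pred x | x in e])).
exact: imset_inj ord_pred_inj.
Qed.

Lemma dl_iter_rot j D a b : dl (iter j (@rot_dissection N) D) a b = dl D (a + j) (b + j).
Proof. by elim: j a b => [|j IH] a b; rewrite ?addn0 //= dl_rot IH !addSnnS. Qed.

(** Invariance yields one inclusion; the other follows because an image has at most as many
    elements. *)
Lemma rot_fixedP j D : dissection D ->
  (iter j (@rot_dissection N) D == D) <-> shift_inv (dl D) (gcdn j N).
Proof.
move=> dD; rewrite shift_inv_gcd //; last by move=> a b; rewrite dlDNl dlDNr.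
split=> [/eqP E a b|inv]; first by rewrite -dl_iter_rot E.
rewrite eq_sym eqEcard; apply/andP; split.
  apply/subsetP => e De; have /is_diagonalP [a [b [_ Ee]]] := dissection_diag dD De; subst e.
  by rewrite -/(dl _ a b) dl_iter_rot inv.
elim: j {inv} => //= j; apply: leq_trans; exact: leq_imset_card.
Qed.

Definition rot_inv m S := [forall i : 'I_N, (vtx n (i + m) \in S) == (vtx n i \in S)].

Lemma rot_invP m S : reflect (forall z, (vtx n (z + m) \in S) = (vtx n z \in S)) (rot_inv m S).
Proof.
apply: (iffP forallP) => [h z|h i]; last by rewrite h.
have E : vtx n (vtx n z) = vtx n z by rewrite vtx_val.
by rewrite -(vtx_congr m E) -[in RHS]E; apply/eqP.
Qed.

Lemma eq_outer L L' : L =2 L' -> outer n L = outer n L'.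
Proof.
move=> E; apply/setP => i; rewrite !inE; congr (~~ _).
by apply: eq_has => a; apply: eq_has => b; rewrite E.
Qed.

Lemma eq_chords L L' : L =2 L' -> chords n L = chords n L'.
Proof.
move=> E; apply/setP => e; rewrite !inE.
by apply: eq_existsb => a; apply: eq_existsb => b; rewrite E.
Qed.

Lemma outer_rot_inv L m : arcsys n L -> shift_inv L m -> m <= N -> rot_inv m (outer n L).
Proof.
move=> sys Lm le_mN; have [range _ _] := sys; apply/rot_invP => z.
rewrite -(vtxD n (z + m) 2) -(vtxD n z 2) !(mem_outer sys); try lia.
congr (~~ _); apply/(coveredP sys)/(coveredP sys) => [] [a [b [Lab h]]].
  have := range _ _ Lab => hab; exists (a - m), (b - m); split; last lia.
  by rewrite -Lm !subnK //; lia.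
by exists (a + m), (b + m); split; [rewrite Lm|lia].
Qed.

(** The core is the one at the centre. A diameter is mapped to itself, since distinct diameters
    cross. Without diameters each diagonal has a unique arc shorter than half a turn; these arcs
    form an invariant arc system whose outer vertices span the central face. *)
Lemma fixed_core_exists D m : 0 < n -> dissection D -> 0 < m -> 2 * m <= N ->
  shift_inv (dl D) m -> exists2 S, (S \in D) || subgon D S & rot_inv m S.
Proof.
move=> n0 dD m0 le_mN inv.
case: (boolP [exists i : 'I_N, [exists k : 'I_N, (k + k == N) && dl D i (i + k)]]) => [|nodiam].
  case/existsP => i /existsP [k /andP [/eqP hk Dik]].
  exists [set vtx n i; vtx n (i + k)]; first by rewrite -/(dl D i (i + k)) Dik.
  have Ekm : m = k.
    case: (ltngtP m k) => h; [exfalso|lia|by []].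
    apply: (dl_nocross dD (c := i + m) (d := i + k + m) _ _ Dik); [lia|lia|by rewrite inv].
  subst m; have sh x y : vtx n (x + k) = vtx n y -> vtx n x = vtx n (y + k).
    by move=> E; rewrite -(vtx_congr k E) -addnA hk vtxDN.
  have sh' x y : vtx n x = vtx n (y + k) -> vtx n (x + k) = vtx n y.
    by move=> E; rewrite (vtx_congr k E) -addnA hk vtxDN.
  have shE x y : (vtx n (x + k) == vtx n y) = (vtx n x == vtx n (y + k)).
    by apply/eqP/eqP => [/sh|/sh'].
  by apply/rot_invP => z; rewrite !inE shE shE -addnA hk vtxDN orbC.
pose L a b := [&& a < b, 2 * (b - a) < N & dl D a b].
have LP a b : L a b -> [/\ a < b, 2 * (b - a) < N & dl D a b] by case/and3P.
have sys : arcsys n L.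
  split=> [a b /LP [h1 h2 h3]|a b|a x b y /LP [h1 h2 h3] /LP [h4 h5 h6] h].
  - by have := dl_range dD (ltac:(lia) : a < b < a + N) h3; lia.
  - by rewrite /L dlDNl dlDNr subnDr ltn_add2r.
  - case: (leqP y b) => // yb; exfalso.
    by apply: (dl_nocross dD _ _ h3 h6); lia.
have Lm : shift_inv L m by move=> a b; rewrite /L inv subnDr ltn_add2r.
exists (outer n L); last by apply: outer_rot_inv => //; lia.
apply/coreP => //; apply: outer_core => // a b hab; split=> [Dab|[/LP [] //|/LP [_ _]]].
  case: (ltngtP (2 * (b - a)) N) => h.
  - by left; rewrite /L Dab; lia.
  - by right; rewrite /L dlDNr dlC Dab; lia.
  - have hb : b - a < N by lia.
    case/negP: nodiam; apply/existsP; exists (vtx n a); apply/existsP; exists (Ordinal hb).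
    have E : vtx n (vtx n a) = vtx n a by rewrite vtx_val.
    rewrite /= -/(nat_of_ord (vtx n a)) /dl E (vtx_congr (b - a) E) subnKC; last lia.
    by rewrite -/(dl D a b) Dab; lia.
by rewrite dlDNr dlC.
Qed.

End Rotation.

(** * Periodic words and dissections with a marked core *)

Fixpoint tail_sums (s : seq nat) : seq nat :=
  if s is x :: s' then sumn s :: tail_sums s' else [::].

Lemma diffs_tail_sums s : diffs (tail_sums s) = s.
Proof. by elim: s => //= x [|y s] IH; rewrite ?IH /= ?addn0 ?subn0 // addnK. Qed.

Lemma tail_sumsE s : tail_sums s = [seq sumn (drop p s) | p <- iota 0 (size s)].
Proof.
elim: s => //= x s ->; congr (_ :: _).
by rewrite -[in RHS]add1n iotaDl -map_comp.
Qed.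

Lemma tail_sums_sorted s : all (ltn 0) s -> sorted (fun x y => y < x) (tail_sums s).
Proof. elim: s => //= x [|y s] IH //= /andP [x0 hs]; have /= -> := IH hs; rewrite andbT; lia. Qed.

(** * A sequence of words is determined by its arcs *)

Section Injectivity.
Variables (n c c' : nat) (W W' : nat -> seq nat).
Local Notation N := n.+2.
Hypothesis WN : forall t, W (t + N) = W t.
Hypotheses (Wpos : forall t, all (ltn 0) (W t)) (Wpos' : forall t, all (ltn 0) (W' t)).
Hypotheses (c1 : 1 < c) (c1' : 1 < c').
Hypothesis HN : forall t, height W (t + N) = (height W t + c%:Z)%R.
Hypothesis HN' : forall t, height W' (t + N) = (height W' t + c'%:Z)%R.
Hypothesis eqL : forall a b, arcW W a b = arcW W' a b.

Lemma height_diff_sum V a b : a <= b ->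
  (height V b - height V a)%R = ((b - a)%:Z - (\sum_(a <= x < b) sumn (V x))%:Z)%R.
Proof. by move=> ab; rewrite /height (big_cat_nat _ (n := a)) //=; lia. Qed.

(** Induction on the length. For [x] under the arc, [sumn (W x)] is the rise of the arc of the first
    letter at [x], which is an arc of both systems; so each of [W] and [W'] bounds the sum of the
    other. *)
Lemma arc_height_eq a b : arcW W a b ->
  (height W b - height W a.+1)%R = (height W' b - height W' a.+1)%R.
Proof.
have [k] := ubnP (b - a); elim: k a b => // k IH a b hk Lab.
have [range _ cross] := arcW_sys WN Wpos c1 HN; have hab := range _ _ Lab.
rewrite !height_diff_sum; try lia; congr (_ - _%:Z)%R.
apply: eq_big_nat => x hx.
have bnd V y z : arcW V y z -> (height V z - height V y.+1 <= (sumn (V y))%:Z)%R.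
  case/arcWP => p [_ _ ->]; rewrite -tail_sum0; have := tail_sum_le V y (leq0n p); lia.
have inner y : arcW W x y -> (height W y - height W x.+1)%R = (height W' y - height W' x.+1)%R.
  by move=> Lxy; apply: IH => //; have := cross _ _ _ _ Lab Lxy; have := range _ _ Lxy; lia.
apply/eqP; rewrite eqn_leq; apply/andP; split.
  case: (posnP (size (W x))) => [/size0nil -> //|h].
  have Lx := arcW_hit c1 HN h; have := inner _ Lx; rewrite eqL in Lx.
  by have := bnd _ _ _ Lx; rewrite hit_height tail_sum0; lia.
case: (posnP (size (W' x))) => [/size0nil -> //|h].
have Lx := arcW_hit c1' HN' h; rewrite -eqL in Lx.
by have := inner _ Lx; have := bnd _ _ _ Lx; rewrite hit_height tail_sum0; lia.
Qed.

(** The rises of the arcs from [t] are the tail sums of the word at [t]. Strictly decreasing lists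
    with the same elements are equal, and [diffs] recovers the letters. *)
Lemma arcW_inj t : W t = W' t.
Proof.
rewrite -[LHS]diffs_tail_sums -[RHS]diffs_tail_sums; congr diffs.
apply: (@irr_sorted_eq _ (fun x y => y < x)); try exact: tail_sums_sorted.
- by move=> x y z /= h1 h2; apply: ltn_trans h2 h1.
- by move=> x /=; rewrite ltnn.
move=> k; rewrite !tail_sumsE; apply/mapP/mapP => [] [p]; rewrite mem_iota => hp ->.
  have Lt := arcW_hit c1 HN (hp : p < size (W t)).
  have E := arc_height_eq Lt; rewrite eqL in Lt; have /arcWP [q [hq _ Eq]] := Lt.
  exists q; first by rewrite mem_iota.
  by rewrite -!/(tail_sum _ _ _); move: E; rewrite hit_height Eq; lia.
have Lt := arcW_hit c1' HN' (hp : p < size (W' t)).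
rewrite -eqL in Lt; have E := arc_height_eq Lt; have /arcWP [q [hq _ Eq]] := Lt.
exists q; first by rewrite mem_iota.
by rewrite -!/(tail_sum _ _ _); move: E; rewrite hit_height Eq; lia.
Qed.
End Injectivity.

Lemma sum_periodic_mul (f : nat -> nat) m d : (forall x, f (x + m) = f x) ->
  \sum_(0 <= x < d * m) f x = d * \sum_(0 <= x < m) f x.
Proof.
move=> fm; elim: d => [|d IH]; first by rewrite big_geq.
rewrite mulSnr (big_cat_nat _ (n := d * m)) //=; last by rewrite leq_addr.
by rewrite IH sum_periodic // mulSnr.
Qed.

Lemma sumn_count n s : all (fun x => 0 < x <= n) s ->
  sumn s = \sum_(1 <= i < n.+1) i * count_mem i s.
Proof.
elim: s => [|x s IH] /= => [_|/andP [hx hs]]; first by rewrite big1 // => i _; rewrite muln0.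
under eq_bigr do rewrite mulnDr; rewrite big_split /= IH //; congr addn.
rewrite (bigD1_seq x) ?mem_index_iota ?iota_uniq //= eqxx muln1 big1 ?addn0 // => i.
by rewrite eq_sym => /negPf ->; rewrite muln0.
Qed.

Definition repeat_word (w : seq (seq nat)) t := nth [::] w (t %% size w).

Definition good_word n m (nu : nat -> nat) (w : seq (seq nat)) :=
  [/\ size w = m, all (fun x => 0 < x <= n) (flatten w) &
    forall i, 0 < i <= n -> count_mem i (flatten w) = nu i].

Definition frame_of n w := (chords n (arcW (repeat_word w)), outer n (arcW (repeat_word w))).

Section CoreWord.
Variables (n m d : nat) (mu : nat -> nat).
Local Notation N := n.+2.
Local Notation frame_of := (frame_of n).
Hypotheses (m0 : 0 < m) (NE : N = d * m) (n0 : 0 < n).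

Lemma period_le : m <= N.
Proof. by rewrite NE leq_pmull //; case: d NE. Qed.

Lemma A_mu_dissection (D : {set {set 'I_N}}) : D \in A_mu n mu -> dissection D.
Proof. by rewrite inE => /andP []. Qed.

Lemma arcs_of_shift (D : {set {set 'I_N}}) (S : {set 'I_N}) : shift_inv (dl D) m -> rot_inv m S -> shift_inv (arcs_of D S) m.
Proof.
move=> hD /rot_invP hS a b; apply/arcs_ofP/arcs_ofP => [] []; rewrite hD => h1 h2 h3.
  by split=> //; [lia|move=> z hz; rewrite -hS; apply: h3; lia].
split=> //; first lia; move=> z hz; have := h3 (z - m).
by rewrite -hS subnK; [apply|]; lia.
Qed.
(* Any core of a dissection invariant under a rotation by [m] that is itself
   invariant comes from a word, so the face sizes away from it are [d]-fold. *)
Lemma core_word D S : D \in A_mu n mu -> shift_inv (dl D) m ->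
  (S \in D) || subgon D S -> rot_inv m S ->
  exists nu w, [/\ good_word n m nu w, frame_of w = (D, S) &
    forall i, 0 < i <= n -> mu i = (#|S| == i.+2) + d * nu i].
Proof.
move=> AD perD DS rotS; have dD := A_mu_dissection AD.
have core_S : core D S by apply/coreP.
pose L := arcs_of D S; have sys : arcsys n L := arcs_of_sys dD core_S.
have perL : shift_inv L m := arcs_of_shift perD rotS.
pose W := word n L; have Wm t : W (t + m) = W t := word_shift sys perL t.
have [_ perN _] := sys; have WN t : W (t + N) = W t := word_shift sys perN t.
have Wpos t : all (ltn 0) (W t) := word_pos sys t.
have sumW : \sum_(0 <= x < N) sumn (W x) <= n.
  under eq_bigr do rewrite (sumn_word sys); exact: children_total sys.
(* The net climb; it can be identified with [#|S|] only afterwards, in [cc], because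
   [card_outer_word] needs the climb as input. *)
pose c' := N - \sum_(0 <= x < N) sumn (W x).
have c'1 : 1 < c' by rewrite /c'; lia.
have HN t : height W (t + N) = (height W t + c'%:Z)%R.
  by rewrite (height_shift WN) [height W N]/height /c'; lia.
have eqL : arcW W =2 L := arcW_word sys.
have cc : c' = #|S|.
  by rewrite -(outer_arcs_of dD core_S) -(eq_outer n eqL) (card_outer_word WN Wpos c'1 HN).
have bnd a b : arcW W a b -> b <= a + n by rewrite eqL => /(arcs_of_bound dD).
have muE i : 0 < i <= n -> mu i = (#|S| == i.+2) + d * \sum_(0 <= a < m) count_mem i (W a).
  move=> hi; have := card_subgons_word WN Wpos c'1 HN bnd (i := i) ltac:(lia).
  rewrite (eq_chords n eqL) chords_arcs_of // cc.
  move: (AD); rewrite inE => /andP [_ /forallP hA].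
  have hi' : i < n.+1 by lia.
  have /= /eqP -> := implyP (hA (Ordinal hi')) (ltac:(lia) : 0 < i).
  rewrite (@sum_periodic (fun x => count_mem i (W x))); last by move=> x; rewrite WN.
  have := @sum_periodic_mul (fun x => count_mem i (W x)) m d (fun x => congr1 _ (Wm x)).
  by rewrite -NE => ->.
pose w := mkseq W m.
have Ww t : repeat_word w t = W t.
  rewrite /repeat_word size_mkseq nth_mkseq ?ltn_pmod // [in RHS](divn_eq t m) addnC.
  by elim: (t %/ m) => [|k IH]; rewrite ?addn0 // mulSnr addnA Wm.
have eqLw : arcW (repeat_word w) =2 L.
  move=> a b; rewrite -eqL /arcW /rec /tail_sum.
  have Eh t : height (repeat_word w) t = height W t.
    by rewrite /height; congr (_ - _%:Z)%R; apply: eq_bigr => x _; rewrite Ww.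
  rewrite Ww !Eh; congr (_ && _ && _).
  by apply: eq_all => t; rewrite Eh.
exists (fun i => \sum_(0 <= a < m) count_mem i (W a)), w; split=> //; last first.
  by rewrite /frame_of (eq_chords n eqLw) (eq_outer n eqLw) chords_arcs_of // outer_arcs_of.
split; first by rewrite size_mkseq.
  apply/allP => x /flattenP [s /mapP [a]]; rewrite mem_iota => /andP [_ ha] -> xW.
  have := allP (Wpos a) _ xW => /= ->; rewrite andTb; apply: leq_trans sumW.
  have -> : \sum_(0 <= t < N) sumn (W t) = sumn (W a) + (\sum_(0 <= t < N) sumn (W t) - sumn (W a)).
    rewrite subnKC // (bigD1_seq a) ?iota_uniq ?mem_index_iota ?leq_addr //.
    by rewrite (leq_trans ha) // period_le.
  apply: leq_trans (leq_addr _ _); elim: (W a) xW => //= y r IH.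
  by rewrite inE => /orP [/eqP <-|/IH h]; [rewrite leq_addr|apply: leq_trans h _; rewrite leq_addl].
move=> i hi; rewrite count_flatten sumnE big_map big_map.
by rewrite /index_iota subn0.
Qed.

End CoreWord.

(** * From words to dissections with a marked invariant core *)

Section GoodWord.
Variables (n m d c : nat) (nu : nat -> nat).
Local Notation N := n.+2.
Hypotheses (m0 : 0 < m) (NE : N = d * m) (c1 : 1 < c).
Hypothesis cE : N = d * (\sum_(1 <= i < n.+1) i * nu i) + c.
Hypothesis cd : 2 < c \/ 1 < d.

Section One.
Variable w : seq (seq nat).
Hypothesis gw : good_word n m nu w.
Local Notation W := (repeat_word w).

Lemma repeat_shift t : W (t + m) = W t.
Proof. by have [E _ _] := gw; rewrite /repeat_word E modnDr. Qed.

Lemma repeatN t : W (t + N) = W t.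
Proof. by have [E _ _] := gw; rewrite /repeat_word NE E addnC modnMDl. Qed.

Lemma mem_repeat x t : x \in W t -> x \in flatten w.
Proof.
have [E _ _] := gw => h; apply/flattenP; exists (W t) => //.
by apply: mem_nth; rewrite E ltn_pmod.
Qed.

Lemma repeat_pos t : all (ltn 0) (W t).
Proof.
have [_ /allP h _] := gw; apply/allP => x /mem_repeat /h; by case/andP.
Qed.

Lemma sum_repeat (f : seq nat -> nat) : \sum_(0 <= x < N) f (W x) = d * \sum_(v <- w) f v.
Proof.
have [E _ _] := gw; rewrite NE (@sum_periodic_mul (fun x => f (W x))); last first.
  by move=> x; rewrite repeat_shift.
rewrite (big_nth [::]) E; congr (_ * _); apply: eq_big_nat => x hx.
by rewrite /repeat_word E modn_small.
Qed.

Lemma repeat_height t : height W (t + N) = (height W t + c%:Z)%R.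
Proof.
rewrite height_shift; last exact: repeatN; congr (_ + _)%R.
have [E1 E2 E3] := gw; rewrite /height sum_repeat.
have -> : \sum_(v <- w) sumn v = \sum_(1 <= i < n.+1) i * nu i.
  rewrite -[LHS](big_map sumn predT id) -sumnE -sumn_flatten (sumn_count E2).
  by apply: eq_big_nat => i hi; rewrite E3 //; lia.
by rewrite {1}cE; lia.
Qed.

Let sys : arcsys n (arcW W) := arcW_sys repeatN repeat_pos c1 repeat_height.

Lemma repeat_arc_shift : shift_inv (arcW W) m.
Proof. exact: arcW_shift repeat_shift (height_shift repeat_shift). Qed.

(** An arc of length [n.+1] would leave only its two ends outer, against [2 < c]; for [1 < d] it
    would cross its translate by [m]. *)
Lemma repeat_bound a b : arcW W a b -> b <= a + n.
Proof.
move=> Lab; have [range _ cross] := sys; have hab := range _ _ Lab.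
case: cd => [c2|d1].
  rewrite leqNgt; apply/negP => hb.
  suff : #|outer n (arcW W)| <= #|[set vtx n a; vtx n b]|.
    by rewrite (card_outer_word repeatN repeat_pos c1 repeat_height) cards2; case: (_ == _); lia.
  apply/subset_leq_card/subsetP => i fi; have [z hz Ez] := vtx_lift a i; subst i; rewrite in_set2.
  case: (ltngtP a z) => [az||->]; [|lia|by rewrite eqxx].
  case: (ltngtP z b) => [zb|bz|->]; [|lia|by rewrite eqxx orbT].
  by move: fi; rewrite (negPf (outer_arc sys Lab _)) // az.
have Lab' : arcW W (a + m) (b + m) by rewrite repeat_arc_shift.
have := cross _ _ _ _ Lab Lab'; have : 2 * m <= N by rewrite NE leq_mul2r d1 orbT.
by lia.
Qed.

Lemma repeat_subgons i : 0 < i <= n ->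
  #|[set S in subgons (chords n (arcW W)) | #|S| == i.+2]| = (c == i.+2) + d * nu i.
Proof.
move=> hi; have [E1 E2 E3] := gw.
rewrite (card_subgons_word repeatN repeat_pos c1 repeat_height repeat_bound); last lia.
congr addn; rewrite (@sum_periodic (fun x => count_mem i (W x))); last by move=> x; rewrite repeatN.
rewrite sum_repeat -E3 // count_flatten sumnE big_map.
by congr muln; apply: eq_bigr.
Qed.
End One.

Variables (mu : nat -> nat).
Hypothesis muE : forall i, 0 < i <= n -> mu i = (c == i.+2) + d * nu i.
Hypothesis n0 : 0 < n.

Definition framed (q : {set {set 'I_N}} * {set 'I_N}) :=
  [/\ q.1 \in A_mu n mu, shift_inv (dl q.1) m, #|q.2| = c, rot_inv m q.2 &
     (q.2 \in q.1) || subgon q.1 q.2].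

Local Notation frame_of := (frame_of n).

Lemma frame_of_framed w : good_word n m nu w -> framed (frame_of w).
Proof.
move=> gw; pose sys := arcW_sys (repeatN gw) (repeat_pos gw) c1 (repeat_height gw).
have dD := chords_dissection sys (repeat_bound gw).
split=> /=.
- rewrite inE dD; apply/forallP => i; apply/implyP => i0.
  by rewrite (repeat_subgons gw) -?muE //; have := ltn_ord i; lia.
- have [range _ _] := sys.
  have imp a b : dl (chords n (arcW (repeat_word w))) a b ->
      dl (chords n (arcW (repeat_word w))) (a + m) (b + m).
    case/(chordsP sys) => x [y [Lxy E]]; apply/(chordsP sys).
    exists (x + m), (y + m); rewrite (repeat_arc_shift gw); split=> //.
    by case: (set2_eq E) => [] [E1 E2]; rewrite (vtx_congr m E1) (vtx_congr m E2) // setUC.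
  move=> a b; apply/idP/idP => [h|]; last exact: imp.
  have imps k x y : dl (chords n (arcW (repeat_word w))) x y ->
      dl (chords n (arcW (repeat_word w))) (x + k * m) (y + k * m).
    move=> hxy; elim: k => [|k IH]; first by rewrite !addn0.
    by rewrite mulSnr !addnA; apply: imp.
  (* Shifting [d.-1] more times completes a full turn, which inverts the shift by [m]. *)
  have := imps d.-1 _ _ h; rewrite -!addnA -mulSn prednK; last by case: d NE.
  by rewrite -NE dlDNl dlDNr.
- exact: card_outer_word (repeatN gw) (repeat_pos gw) c1 (repeat_height gw).
- exact: outer_rot_inv sys (repeat_arc_shift gw) (period_le NE).
- by apply/coreP => //; apply: (outer_core sys) => a b hab; exact: (dl_chords sys hab).
Qed.

Lemma frame_of_inj w w' : good_word n m nu w -> good_word n m nu w' ->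
  frame_of w = frame_of w' -> w = w'.
Proof.
move=> gw gw' [E1 E2].
have sys := arcW_sys (repeatN gw) (repeat_pos gw) c1 (repeat_height gw).
have sys' := arcW_sys (repeatN gw') (repeat_pos gw') c1 (repeat_height gw').
have eqL a b : arcW (repeat_word w) a b = arcW (repeat_word w') a b.
  rewrite -(arcs_of_chords sys (repeat_bound gw)) E1 E2.
  exact: arcs_of_chords sys' (repeat_bound gw') a b.
have [s1 _ _] := gw; have [s2 _ _] := gw'.
apply: (@eq_from_nth _ [::]) => [|i hi]; first by rewrite s2.
have := arcW_inj (repeatN gw) (repeat_pos gw) (repeat_pos gw') c1 c1
  (repeat_height gw) (repeat_height gw') eqL i.
by rewrite /repeat_word s2 -s1 modn_small.
Qed.

Lemma framed_frame_of q : framed q -> exists2 w, good_word n m nu w & frame_of w = q.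
Proof.
case: q => D S [/= AD perD cS rotS DS].
have [nu' [w [[h1 h2 h3] <- muE']]] := core_word m0 NE n0 AD perD DS rotS.
exists w => //; split=> // i hi; rewrite h3 //.
have /eqP := muE' i hi; rewrite muE // cS eqn_add2l eqn_pmul2l => [/eqP->//|].
by case: d NE.
Qed.

Lemma card_framed (P : {set {set {set 'I_N}} * {set 'I_N}}) (l : seq (seq (seq nat))) :
  uniq l -> (forall w, w \in l <-> good_word n m nu w) ->
  (forall q, q \in P <-> framed q) -> #|P| = size l.
Proof.
move=> ul lP PP; rewrite -(size_map frame_of).
have /card_uniqP <- : uniq [seq frame_of w | w <- l].
  by rewrite map_inj_in_uniq // => w w' /lP gw /lP gw'; apply: frame_of_inj.
apply: eq_card => q; apply/idP/mapP => [/PP/framed_frame_of [w gw <-]|[w /lP gw ->]].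
  by exists w => //; apply/lP.
by apply/PP; apply: frame_of_framed.
Qed.

End GoodWord.

(** * Enumeration of words *)

Section EnumWords.
Variable n : nat.
Implicit Types (nu : nat -> nat) (w : seq (seq nat)).

Definition remove nu i j := nu j - (j == i).
Definition push i w := if w is u :: w' then (i :: u) :: w' else [::].

(** Recursion on the first symbol: either the first block is empty, or it begins with an available
    letter [i]. The inner [fix] lowers the number of blocks, the outer one the number [K] of letters
    left. *)
Fixpoint words K :=
  match K with
  | 0 => fun m nu => [:: nseq m [::]]
  | K'.+1 => fix words_aux m nu :=
      if m is m'.+1 then
        [seq [::] :: w | w <- words_aux m' nu] ++
        flatten [seq [seq push i w | w <- words K' m (remove nu i)] | i <- iota 1 n & 0 < nu i]
      else [::]
  end.

Lemma wordsS K m nu : words K.+1 m.+1 nu = [seq [::] :: w | w <- words K.+1 m nu] ++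
  flatten [seq [seq push i w | w <- words K m.+1 (remove nu i)] | i <- iota 1 n & 0 < nu i].
Proof. by []. Qed.

Lemma good_nil m nu w : good_word n m.+1 nu ([::] :: w) <-> good_word n m nu w.
Proof. by split=> [] [h1 h2 h3]; split=> //=; [case: h1|rewrite h1]. Qed.

Lemma good_push m nu i u w : good_word n m.+1 nu ((i :: u) :: w) <->
  [/\ 0 < i <= n, 0 < nu i & good_word n m.+1 (remove nu i) (u :: w)].
Proof.
split=> [[h1 /= /andP [hi h2] h3]|[hi h0 [h1 h2 h3]]].
  split=> //; first by rewrite -h3 // eqxx.
  by split=> // j hj; rewrite /remove -h3 // [j == i]eq_sym addKn.
split=> //=; first by rewrite hi.
move=> j hj; have /= -> := h3 j hj; rewrite /remove eq_sym.
by case: eqP => [->|] //=; lia.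
Qed.

Lemma sum_remove nu i : 0 < i <= n -> 0 < nu i ->
  \sum_(1 <= j < n.+1) nu j = (\sum_(1 <= j < n.+1) remove nu i j).+1.
Proof.
move=> hi h0; rewrite !(bigD1_seq i) ?mem_index_iota ?iota_uniq //= /remove eqxx.
rewrite -addSn; congr addn; first by lia.
by apply: eq_bigr => j /negPf ->; rewrite subn0.
Qed.

Lemma prod_remove nu i : 0 < i <= n -> 0 < nu i ->
  \prod_(1 <= j < n.+1) (nu j)`! = nu i * \prod_(1 <= j < n.+1) (remove nu i j)`!.
Proof.
move=> hi h0; rewrite !(bigD1_seq i) ?mem_index_iota ?iota_uniq //= /remove eqxx.
rewrite mulnA; congr muln; first by case: (nu i) h0 => // k _; rewrite factS subn1.
by apply: eq_bigr => j /negPf ->; rewrite subn0.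
Qed.

Lemma good_flatten_nil m nu w : \sum_(1 <= j < n.+1) nu j = 0 ->
  good_word n m nu w <-> w = nseq m [::].
Proof.
move=> h0; have nu0 i : 0 < i <= n -> nu i = 0.
  move=> hi; move: h0; rewrite (bigD1_seq i) ?mem_index_iota ?iota_uniq //=; lia.
have fl k : flatten (nseq k [::]) = [::] :> seq nat by elim: k.
split=> [[h1 h2 h3]|->]; last by split; rewrite ?size_nseq ?fl // => i /nu0 ->.
have Ef : flatten w = [::].
  case E : (flatten w) h2 h3 => [//|x s] /= /andP [hx _] /(_ x hx).
  by rewrite eqxx nu0.
rewrite -h1; elim: w Ef {h1 h2 h3} => //= u w IH.
by case: u => //= /IH {1}->.
Qed.

Lemma mem_words K m nu w : \sum_(1 <= j < n.+1) nu j = K ->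
  w \in words K m nu <-> good_word n m nu w.
Proof.
elim: K m nu w => [|K IHK] m nu w EK.
  rewrite (good_flatten_nil m w EK) /= inE; split=> [/eqP//|->]; exact: eqxx.
elim: m w => [|m IHm] w.
  split=> // -[/size0nil -> _ h]; move: EK; rewrite big_nat big1 // => i hi.
  by rewrite -h.
have remK i : 0 < i <= n -> 0 < nu i -> \sum_(1 <= j < n.+1) remove nu i j = K.
  by move=> hi h0; apply/eq_add_S; rewrite -sum_remove.
rewrite wordsS mem_cat; split.
  case/orP => [/mapP [w' /IHm gw ->]|]; first exact/good_nil.
  case/flattenP => s /mapP [i]; rewrite mem_filter mem_iota => /andP [h0 hi] -> /mapP [w'].
  have {}hi : 0 < i <= n by lia.
  rewrite IHK ?remK // => gw ->; case: w' gw => [[//]|u w' gw] /=.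
  exact/good_push.
case: w => [[]//|[|i u] w] gw; apply/orP.
  by left; apply/mapP; exists w => //; apply/IHm/good_nil.
have [hi h0 gw'] := proj1 (good_push _ _ _ _ _) gw.
right; apply/flattenP; exists [seq push i w | w <- words K m.+1 (remove nu i)].
  by apply/mapP; exists i => //; rewrite mem_filter h0 mem_iota; lia.
by apply/mapP; exists (u :: w) => //; apply/IHK => //; apply: remK.
Qed.

Lemma uniq_words K m nu : \sum_(1 <= j < n.+1) nu j = K -> uniq (words K m nu).
Proof.
elim: K m nu => [//|K IHK] m nu EK; elim: m => // m IHm.
have remK i : 0 < i <= n -> 0 < nu i -> \sum_(1 <= j < n.+1) remove nu i j = K.
  by move=> hi h0; apply/eq_add_S; rewrite -sum_remove.
have mem_i i : i \in [seq i <- iota 1 n | 0 < nu i] ->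
    [/\ 0 < i <= n, 0 < nu i & \sum_(1 <= j < n.+1) remove nu i j = K].
  rewrite mem_filter mem_iota => /andP [h0 hi].
  by have h : 0 < i <= n by [lia]; split=> //; apply: remK.
have good_ne i w : i \in [seq i <- iota 1 n | 0 < nu i] ->
    w \in words K m.+1 (remove nu i) -> exists u w', w = u :: w'.
  by case/mem_i => _ _ E /(mem_words _ _ E) [+ _ _]; case: w => // u w' _; exists u, w'.
rewrite wordsS cat_uniq; apply/and3P; split.
- by rewrite map_inj_uniq // => w w' [].
- apply/hasPn => w /flattenP [s /mapP [i hi ->] /mapP [w' hw' ->]].
  have [u [v ->]] := good_ne i w' hi hw'.
  by apply/negP => /mapP [].
- have : uniq [seq i <- iota 1 n | 0 < nu i] by rewrite filter_uniq ?iota_uniq.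
  elim: [seq i <- iota 1 n | 0 < nu i] mem_i good_ne => //= i s IHs mem_i good_ne /andP [nis us].
  rewrite cat_uniq; apply/and3P; split.
  + have [_ _ E] := mem_i i (mem_head _ _).
    rewrite map_inj_in_uniq ?IHK // => w w' hw hw'.
    have [u [v ->]] := good_ne _ _ (mem_head _ _) hw.
    by have [u' [v' ->]] := good_ne _ _ (mem_head _ _) hw' => /= -[-> ->].
  + apply/hasPn => w /flattenP [t /mapP [j hj ->] /mapP [w' hw' ->]].
    apply/negP => /mapP [w2 hw2].
    have hj' : j \in i :: s by rewrite inE hj orbT.
    have [u [v ->]] := good_ne _ _ hj' hw'.
    have [u' [v' ->]] := good_ne _ _ (mem_head _ _) hw2 => /= -[E _ _].
    by move: nis; rewrite -E hj.
  + apply: IHs => // [j hj|j w hj]; first by apply: mem_i; rewrite inE hj orbT.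
    by apply: good_ne; rewrite inE hj orbT.
Qed.

(** The two branches of [wordsS] match the splitting of [m + K] symbols, when [K] is positive, into
    [m] separators and [nu i] copies of each letter. *)
Lemma size_words K m nu : \sum_(1 <= j < n.+1) nu j = K ->
  size (words K m.+1 nu) * (m`! * \prod_(1 <= j < n.+1) (nu j)`!) = (m + K)`!.
Proof.
elim: K m nu => [|K IHK] m nu EK.
  rewrite /= mul1n addn0 big_nat big1 ?muln1 // => i hi.
  move: EK; rewrite (bigD1_seq i) ?mem_index_iota ?iota_uniq //=.
  by case: (nu i).
(* The premise reads [0 = 0] for [p = 0] and otherwise comes from the inner induction. *)
have main p : size (words K.+1 p nu) * (p`! * \prod_(1 <= j < n.+1) (nu j)`!) = p * (p + K)`! ->
    size (words K.+1 p.+1 nu) * (p`! * \prod_(1 <= j < n.+1) (nu j)`!) = (p + K.+1)`!.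
  move=> hA; rewrite wordsS size_cat size_map mulnDl hA addnS factS -addnS mulnDl; congr addn.
  rewrite size_flatten /shape -map_comp sumnE big_map big_filter big_distrl /= -EK big_distrl /=.
  have -> : iota 1 n = index_iota 1 n.+1 by rewrite /index_iota subn1.
  rewrite big_mkcond; apply: eq_big_nat => i hi.
  case: posnP => [-> //|h0]; rewrite size_map (prod_remove hi h0) [p`! * _]mulnCA mulnCA.
  by rewrite IHK //; apply/eq_add_S; rewrite -sum_remove.
elim: m => [|m IHm]; first exact: main.
by apply: main; rewrite factS -mulnA mulnCA IHm addSnnS.
Qed.
End EnumWords.

(** * The q-analogue *)

Section QAnalogue.
Local Open Scope ring_scope.

Lemma qfact0 : qfact 0 = 1.
Proof. by rewrite /qfact big_ord0. Qed.

Lemma qfactS a : qfact a.+1 = qfact a * qint a.+1.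
Proof. by rewrite /qfact big_ord_recr. Qed.

Lemma qint_mul a : qint a * ('X - 1) = 'X^a - 1.
Proof. by rewrite mulrC -subrX1. Qed.

Lemma Cyclotomic1 : 'Phi_1 = 'X - 1.
Proof. by have := prod_Cyclotomic (isT : (0 < 1)%N); rewrite big_seq1 expr1. Qed.

(** A common bound [B], instead of the divisors of [a], lets products for different [a] be compared
    factor by factor. *)
Lemma qint_Cyclotomic a B : (0 < a < B)%N ->
  qint a = \prod_(2 <= e < B) 'Phi_e ^+ (e %| a)%N.
Proof.
move=> /andP [a0 aB]; have nz : ('X - 1 : {poly int}) != 0.
  by rewrite -Cyclotomic1 monic_neq0 ?Cyclotomic_monic.
apply: (mulIf nz); rewrite qint_mul -prod_Cyclotomic //.
rewrite -Cyclotomic1 mulrC.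
have -> : \prod_(d <- divisors a) 'Phi_d = \prod_(1 <= e < B) 'Phi_e ^+ (e %| a)%N.
  rewrite [RHS](eq_bigr (fun e => if (e %| a)%N then 'Phi_e else 1)); last first.
    by move=> e _; case: (e %| a)%N; rewrite ?expr1 ?expr0.
  rewrite -big_mkcond -[RHS]big_filter; apply: perm_big; apply: uniq_perm.
  - exact: divisors_uniq.
  - by rewrite filter_uniq ?iota_uniq.
  - move=> e; rewrite -dvdn_divisors // mem_filter mem_index_iota.
    case: (boolP (e %| a)%N) => //= ea; have := dvdn_leq a0 ea; have := dvdn_gt0 a0 ea; lia.
by rewrite big_ltn ?dvd1n ?expr1 //; lia.
Qed.

Lemma qfact_Cyclotomic a B : (a < B)%N -> qfact a = \prod_(2 <= e < B) 'Phi_e ^+ (a %/ e).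
Proof.
elim: a => [|a IH] aB; first by rewrite qfact0 big1 // => e _; rewrite div0n expr0.
rewrite qfactS IH; last by lia.
rewrite (@qint_Cyclotomic a.+1 B) // -big_split; apply: eq_big_nat => e he /=.
by rewrite -exprD divnS 1?addnC //; lia.
Qed.

(* [qfact a] with the factor [qint d] removed from each [qint (d * b)]. *)
Fixpoint qfact_part d a : {poly int} :=
  if a is a'.+1 then
    qfact_part d a' * (if (d %| a)%N then qint (a %/ d) \Po 'X^d else qint a)
  else 1.

Lemma qint_comp d b : qint (d * b) = qint d * (qint b \Po 'X^d).
Proof.
have nz : ('X - 1 : {poly int}) != 0 by rewrite -Cyclotomic1 monic_neq0 ?Cyclotomic_monic.
apply: (mulIf nz); rewrite qint_mul mulrAC qint_mul.
have := congr1 (fun p => p \Po 'X^d) (qint_mul b).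
by rewrite comp_polyM !comp_polyB comp_Xn_poly comp_polyX comp_polyC -exprM mulrC => ->.
Qed.

Lemma qfact_partE d a : (0 < d)%N -> qfact a = qint d ^+ (a %/ d) * qfact_part d a.
Proof.
move=> d0; elim: a => [|a IH]; first by rewrite qfact0 div0n expr0 mul1r.
rewrite qfactS IH /= divnS //; case: (boolP (d %| a.+1)%N) => h; last by rewrite mulrA.
rewrite -{1}(divnK h) mulnC qint_comp add1n exprS divnS // h add1n; ring.
Qed.

(** * Evaluation at a primitive [d]-th root of unity *)

Section Eval.
Variables (d : nat) (x : algC).
Hypothesis px : d.-primitive_root x.

Definition ev (p : {poly int}) : algC := (map_poly (fun z : int => z%:~R) p).[x].

Lemma evM p q : ev (p * q) = ev p * ev q.
Proof. by rewrite /ev rmorphM hornerM. Qed.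

Lemma ev1 : ev 1 = 1.
Proof. by rewrite /ev rmorph1 hornerC. Qed.

Lemma evX p k : ev (p ^+ k) = ev p ^+ k.
Proof. by rewrite /ev rmorphXn horner_exp. Qed.

Lemma ev_prod I (r : seq I) (P : pred I) (F : I -> {poly int}) :
  ev (\prod_(i <- r | P i) F i) = \prod_(i <- r | P i) ev (F i).
Proof. exact: (big_morph ev evM ev1). Qed.

Lemma ev_qint a : ev (qint a) = \sum_(i < a) x ^+ i.
Proof.
rewrite /ev /qint rmorph_sum horner_sum; apply: eq_bigr => i _.
by rewrite /= map_polyXn hornerXn.
Qed.

Lemma ev_qint_comp b : ev (qint b \Po 'X^d) = b%:R.
Proof.
rewrite /ev map_comp_poly map_polyXn horner_comp hornerXn (prim_expr_order px).
rewrite /qint rmorph_sum horner_sum (eq_bigr (fun _ => 1)) ?sumr_const ?card_ord // => i _.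
by rewrite /= map_polyXn hornerXn expr1n.
Qed.

Lemma ev_qint_mul a : (x - 1) * ev (qint a) = x ^+ a - 1.
Proof. by rewrite ev_qint -subrX1. Qed.

Lemma ev_qint_mod a : (1 < d)%N -> ev (qint a) = ev (qint (a %% d)).
Proof.
move=> d1; have nz : x - 1 != 0.
  by rewrite subr_eq0 -[x]expr1 -(prim_order_dvd px) dvdn1; case: d d1 => [|[]].
by apply: (mulfI nz); rewrite !ev_qint_mul (prim_expr_mod px).
Qed.

Lemma ev_qfact_neq0 a : (a < d)%N -> ev (qfact a) != 0.
Proof.
elim: a => [|a IH] ad; first by rewrite qfact0 ev1 oner_eq0.
rewrite qfactS evM mulf_neq0 ?IH //; first exact: ltnW.
apply/eqP => E; have := ev_qint_mul a.+1; rewrite E mulr0 => /esym/eqP.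
by rewrite subr_eq0 -(prim_order_dvd px) => /dvdn_leq; lia.
Qed.

(** Each full block of [d] factors contributes its index, from the modified multiple of [d], and
    [qfact d.-1], since the values of [qint] at [x] have period [d] for [1 < d]. *)
Lemma ev_qfact_part a : ev (qfact_part d a) =
  (a %/ d)`!%:R * ev (qfact d.-1) ^+ (a %/ d) * ev (qfact (a %% d)).
Proof.
have d0 := prim_order_gt0 px.
elim: a => [|a IH]; first by rewrite /= div0n mod0n qfact0 !ev1 expr0 !mulr1.
rewrite /= evM IH divnS //; case: (boolP (d %| a.+1)%N) => h.
  have Er : (a %% d = d.-1)%N.
    move: h; rewrite /dvdn -addn1 -modnDml => /eqP h; have := ltn_pmod a d0.
    case: (ltngtP (a %% d + 1) d) => [lt| |E]; try lia.
    by move: h; rewrite modn_small //; lia.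
  rewrite ev_qint_comp add1n factS (eqP h) qfact0 ev1 exprS Er mulr1 natrM.
  by ring.
have d1 : (1 < d)%N by case: d d0 h => [|[|k]] //; rewrite dvd1n.
have Er : (a.+1 %% d = (a %% d).+1)%N.
  have lt := ltn_pmod a d0; rewrite -addn1 -modnDml addn1 modn_small //.
  rewrite ltn_neqAle lt andbT; apply: contra h => /eqP E.
  by rewrite /dvdn -addn1 -modnDml addn1 E modnn.
by rewrite add0n Er qfactS evM ev_qint_mod // Er; ring.
Qed.
End Eval.

(** * The polynomial of [mu], its integrality and its values *)

Section Amu.
Variables (n : nat) (mu : nat -> nat).
Hypothesis hn : n = (\sum_(1 <= i < n.+1) i * mu i)%N.
Local Notation k := (\sum_(1 <= i < n.+1) mu i)%N.
Local Notation quot d := (\sum_(1 <= i < n.+1) mu i %/ d)%N.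
Local Notation rest d := (\sum_(1 <= i < n.+1) mu i %% d)%N.

Lemma sum_divn d : k = (quot d * d + rest d)%N.
Proof.
rewrite big_distrl /= -big_split; apply: eq_bigr => i _; exact: divn_eq.
Qed.

Lemma divn_quot_rest d : (0 < d)%N -> ((n + k) %/ d = quot d + (n + rest d) %/ d)%N.
Proof. by move=> d0; rewrite (sum_divn d) addnCA divnMDl. Qed.

(** Here [hn] makes the quotient a polynomial: if [rest d] is positive then [n + rest d] reaches
    [n.+1], and if it is zero then [d] divides every [mu i], hence [n], hence not [n.+1]. *)
Lemma floor_le d : (1 < d)%N -> (n.+1 %/ d + quot d <= (n + k) %/ d)%N.
Proof.
move=> d1; have d0 := ltnW d1; rewrite divn_quot_rest // addnC leq_add2l.
case: (posnP (rest d)) => [E|h]; last by apply: leq_div2r; lia.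
suff dn : (d %| n)%N.
  rewrite E addn0 divnS //; case: (boolP (d %| n.+1)%N) => // h.
  by move: h; rewrite -addn1 dvdn_addr // dvdn1; lia.
rewrite hn big_nat; apply: (big_ind (fun v => d %| v)%N) => [|u v|i hi]; [exact: dvdn0|exact: dvdn_add|].
apply: dvdn_mull; rewrite /dvdn; move: E; rewrite (bigD1_seq i) ?mem_index_iota ?iota_uniq //=.
by case: (mu i %% d)%N.
Qed.

Lemma a_mu_exists : exists a : {poly int},
  a * (qint n.+1 * qfact n * \prod_(1 <= i < n.+1) qfact (mu i)) = qfact (n + k).
Proof.
have le_mu i : (1 <= i < n.+1 -> mu i <= k)%N.
  by move=> hi; rewrite (bigD1_seq i) ?mem_index_iota ?iota_uniq //= leq_addr.
pose B := (n + k).+2.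
exists (\prod_(2 <= e < B) 'Phi_e ^+ ((n + k) %/ e - (n.+1 %/ e + quot e))).
rewrite [qint _ * _]mulrC -qfactS.
have hB1 : (n.+1 < B)%N by rewrite /B; lia.
have hB2 : (n + k < B)%N by rewrite /B; lia.
rewrite (qfact_Cyclotomic hB1) (qfact_Cyclotomic hB2).
have -> : \prod_(1 <= i < n.+1) qfact (mu i) =
    \prod_(1 <= i < n.+1) \prod_(2 <= e < B) 'Phi_e ^+ (mu i %/ e).
  by apply: eq_big_nat => i hi; apply: qfact_Cyclotomic; have := le_mu i hi; rewrite /B; lia.
rewrite exchange_big /= -!big_split; apply: eq_big_nat => e /= he.
rewrite prodrXr -!exprD subnK //; apply: floor_le; lia.
Qed.

Variable d : nat.

(* [c] is the size of the invariant core (2 for a diameter) and [nu i] the number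
   of rotation orbits of the remaining faces with [i + 2] vertices. *)
Definition residual c (nu : nat -> nat) := [/\ (1 < c <= n.+2)%N &
  forall i, (0 < i <= n)%N -> mu i = ((c == i.+2) + d * nu i)%N].

(** The first identity says that [c] is the net climb per turn of any path with [nu i] letters [i]
    per period. *)
Lemma residual_sum c nu : residual c nu ->
  n.+2 = (d * (\sum_(1 <= i < n.+1) i * nu i) + c)%N /\
  (k = d * (\sum_(1 <= i < n.+1) nu i) + (2 < c))%N.
Proof.
case=> hc muE.
have sel (f : nat -> nat) : (\sum_(1 <= i < n.+1) f i * (c == i.+2) = (2 < c) * f (c - 2))%N.
  case: (ltnP 2 c) => h.
    rewrite (bigD1_seq (c - 2)%N) ?mem_index_iota ?iota_uniq //=; last by lia.
    have -> : c == (c - 2).+2 by lia.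
    rewrite muln1 mul1n big1 ?addn0 // => i hi.
    by rewrite (_ : c == i.+2 = false) ?muln0 //; lia.
  rewrite big_nat big1 // => i hi; have -> : c == i.+2 = false by lia.
  by rewrite muln0.
split.
  rewrite {1}hn (eq_big_nat _ _ (F2 := fun i => i * (c == i.+2) + d * (i * nu i))%N); last first.
    by move=> i hi; rewrite muE ?mulnDr 1?(mulnCA i); lia.
  by rewrite big_split /= (sel id) -big_distrr /=; case: (ltnP 2 c); lia.
rewrite (eq_big_nat _ _ (F2 := fun i => 1 * (c == i.+2) + d * nu i)%N); last first.
  by move=> i hi; rewrite muE // mul1n.
by rewrite big_split /= (sel (fun=> 1%N)) -big_distrr /= muln1 addnC.
Qed.

Variables (a : {poly int}) (m : nat) (x : algC).
Hypothesis aE : a * (qint n.+1 * qfact n * \prod_(1 <= i < n.+1) qfact (mu i)) = qfact (n + k).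
Hypothesis px : d.-primitive_root x.
Hypothesis NE : n.+2 = (d * m)%N.

(** All factors [qint d] are collected in one power. The remaining factors do not vanish at [x], so
    the exponent decides whether [a] does. *)
Lemma a_mu_part : (1 < d)%N ->
  a * (qfact_part d n.+1 * \prod_(1 <= i < n.+1) qfact_part d (mu i)) =
  qint d ^+ ((n + k) %/ d - (n.+1 %/ d + quot d)) * qfact_part d (n + k).
Proof.
move=> d1; have d0 := ltnW d1.
have nz : qint d ^+ (n.+1 %/ d + quot d) != 0.
  apply: expf_neq0; apply/eqP => E; have := qint_mul d; rewrite E mul0r => /esym/eqP.
  by rewrite -size_poly_eq0 size_XnsubC.
apply: (mulfI nz); rewrite [RHS]mulrA -exprD subnKC ?floor_le //.
rewrite -qfact_partE // -aE [qint _ * _]mulrC -qfactS (@qfact_partE d n.+1) //.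
have -> : \prod_(1 <= i < n.+1) qfact (mu i) =
    \prod_(1 <= i < n.+1) (qint d ^+ (mu i %/ d) * qfact_part d (mu i)).
  by apply: eq_bigr => i _; apply: qfact_partE.
by rewrite big_split /= prodrXr exprD; ring.
Qed.

Lemma ev_part_neq0 b : ev x (qfact_part d b) != 0.
Proof.
have d0 := prim_order_gt0 px.
rewrite (ev_qfact_part px) !mulf_neq0 ?expf_neq0 // ?(ev_qfact_neq0 px) ?ltn_pmod ?prednK //.
by rewrite pnatr_eq0 -lt0n fact_gt0.
Qed.

(** Both sides of [a_mu_part] carry the same power of the value of [qfact d.-1], which is non-zero;
    the factorials that remain are those of the word count. *)
Lemma a_mu_eval c nu : (1 < d)%N -> residual c nu ->
  ev x a * (m.-1`! * \prod_(1 <= i < n.+1) (nu i)`!)%:R =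
  (m.-1 + \sum_(1 <= i < n.+1) nu i)`!%:R.
Proof.
move=> d1 res; have d0 := ltnW d1; have [hc muE] := res; have [cE kE] := residual_sum res.
have m0 : (0 < m)%N by case: m NE; rewrite ?muln0.
set K := (\sum_(1 <= i < n.+1) nu i)%N in kE *.
have Em : (d * m = d * m.-1 + d)%N by rewrite -{1}(prednK m0) mulnSr.
have divq q r : (r < d)%N -> ((d * q + r) %/ d = q)%N /\ ((d * q + r) %% d = r)%N.
  by move=> h; rewrite mulnC divnMDl // divn_small // addn0 modnMDl modn_small.
have [En1 En1'] : (n.+1 %/ d = m.-1)%N /\ (n.+1 %% d = d.-1)%N.
  have -> : n.+1 = (d * m.-1 + d.-1)%N by lia.
  by apply: divq; lia.
have mu_div i : (0 < i <= n)%N -> (mu i %/ d = nu i)%N /\ (mu i %% d = (c == i.+2))%N.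
  by move=> hi; rewrite muE // addnC; apply: divq; case: (c == _); lia.
have quotE : quot d = K by apply: eq_big_nat => i hi; apply: (proj1 (mu_div i _)); lia.
have [Enk Enk'] : ((n + k) %/ d = m.-1 + K)%N /\ ev x (qfact ((n + k) %% d)) = ev x (qfact d.-1).
  case: (ltnP 2 c) => h3.
    have -> : (n + k = d * (m.-1 + K) + d.-1)%N by rewrite mulnDr kE h3; lia.
    by have [-> ->] := divq (m.-1 + K)%N d.-1 ltac:(lia).
  (* For [c = 2] the remainder of [n + k] is [0] rather than [d.-1], but [d] divides 2, and
     [qfact 1] and [qfact 0] agree. *)
  have Ed : d = 2.
    have E2 : (2 = d * (m - \sum_(1 <= i < n.+1) i * nu i))%N by rewrite mulnBr; lia.
    have : (d %| 2)%N by rewrite E2 dvdn_mulr.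
    by move/dvdn_leq; lia.
  have -> : (n + k = d * (m.-1 + K) + 0)%N.
    by rewrite mulnDr kE ltnNge h3; lia.
  have [-> ->] := divq (m.-1 + K)%N 0%N ltac:(lia).
  by rewrite Ed qfactS /= qfact0 mul1r /qint big_ord1 expr0.
have := congr1 (ev x) (a_mu_part d1).
rewrite Enk En1 quotE subnn expr0 mul1r (evM x a) (evM x (qfact_part d n.+1)) ev_prod !(ev_qfact_part px) Enk Enk' En1 En1'.
have -> : \prod_(1 <= i < n.+1) ev x (qfact_part d (mu i)) =
    \prod_(1 <= i < n.+1) ((nu i)`!%:R * ev x (qfact d.-1) ^+ nu i).
  apply: eq_big_nat => i hi; rewrite (ev_qfact_part px); have [-> ->] := mu_div i hi.
  by case: (_ == _); rewrite /= ?qfactS qfact0 ?mul1r /qint ?big_ord1 ?expr0 ev1 mulr1.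
rewrite big_split /= prodrXr -/K => E.
have nz : ev x (qfact d.-1) ^+ m.-1 * ev x (qfact d.-1) * ev x (qfact d.-1) ^+ K != 0.
  by rewrite !mulf_neq0 ?expf_neq0 // (ev_qfact_neq0 px) //; lia.
apply: (mulIf nz); rewrite natrM natr_prod; move: E; rewrite exprD.
set A := ev x a; set f := ev x _; set p := \prod_(1 <= i < _) _%:R => E.
transitivity (A * (m.-1`!%:R * f ^+ m.-1 * f * (p * f ^+ K))); first by ring.
by rewrite E; ring.
Qed.

(** If [rest d] is at least 2, then [n + rest d] reaches [d * m] while [n.+1] does not, so the
    exponent of [qint d] is positive and [a] vanishes. A single remainder 1 at [i] gives [c = i.+2],
    none gives [c = 2]. *)
Lemma a_mu_eval_neq0 : (1 < d)%N -> ev x a != 0 -> exists c nu, residual c nu.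
Proof.
move=> d1 nz; have d0 := ltnW d1.
have m0 : (0 < m)%N by case: m NE; rewrite ?muln0.
have Em : (d * m = d * m.-1 + d)%N by rewrite -{1}(prednK m0) mulnSr.
have r1 : (rest d <= 1)%N.
  rewrite leqNgt; apply/negP => r2.
  have gt0 : (0 < (n + k) %/ d - (n.+1 %/ d + quot d))%N.
    have h : (m <= (n + rest d) %/ d)%N by rewrite leq_divRL //; lia.
    have h' : (n.+1 %/ d < m)%N by rewrite ltn_divLR //; lia.
    by rewrite divn_quot_rest //; lia.
  have := congr1 (ev x) (a_mu_part d1); rewrite (evM x a) (evM x (qfact_part d n.+1)) (evM x (_ ^+ _)) evX.
  have -> : ev x (qint d) = 0.
    have x1 : x - 1 != 0.
      by rewrite subr_eq0 -[x]expr1 -(prim_order_dvd px) dvdn1; lia.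
    by apply: (mulfI x1); rewrite ev_qint_mul (prim_expr_order px) subrr mulr0.
  rewrite expr0n (gtn_eqF gt0) mulr0n mul0r => /eqP.
  rewrite !mulf_eq0 (negPf nz) (negPf (ev_part_neq0 _)) !orFb ev_prod prodf_seq_eq0 => /hasP [i _].
  by rewrite (negPf (ev_part_neq0 _)) andbF.
case: (posnP (rest d)) => [r0|rpos].
  exists 2, (fun i => mu i %/ d)%N; split=> // i hi; have -> : 2 == i.+2 = false by lia.
  move: r0; rewrite {1}(divn_eq (mu i) d) (bigD1_seq i) ?mem_index_iota ?iota_uniq //=; lia.
have [i hi ri] : exists2 i, (1 <= i < n.+1)%N & (mu i %% d != 0)%N.
  have /hasP [i hi ri] : has (fun i => mu i %% d != 0)%N (index_iota 1 n.+1).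
    apply: contraTT rpos => /hasPn h; rewrite big_seq big1 // => i /h.
    by rewrite negbK => /eqP.
  by exists i; rewrite -?mem_index_iota.
exists i.+2, (fun i => mu i %/ d)%N; split; first lia.
move=> j hj; rewrite !eqSS {1}(divn_eq (mu j) d); move: r1.
rewrite (bigD1_seq i) ?mem_index_iota ?iota_uniq //=.
case: (eqVneq i j) => [<-|nij]; first by lia.
rewrite big_mkcond (bigD1_seq j) ?mem_index_iota ?iota_uniq //= eq_sym nij.
by lia.
Qed.
End Amu.

End QAnalogue.

(** * Cyclic sieving *)

Section Count.
Variables (n : nat) (mu : nat -> nat) (j : nat).
Local Notation N := n.+2.
Hypothesis n0 : 0 < n.
Hypothesis hn : n = \sum_(1 <= i < n.+1) i * mu i.
Let m := gcdn j N.
Let d := N %/ m.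

Let m0 : 0 < m. Proof. by rewrite gcdn_gt0 orbT. Qed.
Let NE : N = d * m. Proof. by rewrite /d divnK // dvdn_gcdr. Qed.

Definition fixed := [set D in A_mu n mu | iter j (@rot_dissection N) D == D].

Lemma fixedP D : D \in fixed <-> D \in A_mu n mu /\ shift_inv (dl D) m.
Proof.
rewrite inE; split=> [/andP [AD]|[AD h]].
  by rewrite (rot_fixedP j (A_mu_dissection AD)).
by rewrite AD; apply/(rot_fixedP j (A_mu_dissection AD)).
Qed.

Definition frames c := [set q : {set {set 'I_N}} * {set 'I_N} |
  [&& q.1 \in fixed, #|q.2| == c, rot_inv m q.2 & (q.2 \in q.1) || subgon q.1 q.2]].

Lemma card_frames c nu : 2 < c \/ 1 < d -> residual n mu d c nu ->
  #|frames c| * (m.-1`! * \prod_(1 <= i < n.+1) (nu i)`!) =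
    (m.-1 + \sum_(1 <= i < n.+1) nu i)`!.
Proof.
move=> cd res; have [hc muE] := res; have [cE _] := residual_sum hn res.
rewrite -(size_words _ (erefl _)) prednK //; congr muln.
have c1 : 1 < c by lia.
apply: (card_framed m0 NE c1 cE cd muE n0).
- exact: uniq_words.
- by move=> w; apply: mem_words.
- move=> q; rewrite inE; split=> [/and4P [/fixedP [h1 h2] /eqP h3 h4 h5]|[h1 h2 h3 h4 h5]].
    by split.
  by apply/and4P; split=> //; [apply/fixedP | apply/eqP].
Qed.

Lemma fixed_residual D : D \in fixed -> 1 < d -> exists c nu, residual n mu d c nu /\
  exists2 S, (D, S) \in frames c & #|S| = c.
Proof.
move=> /[dup] fD /fixedP [AD perD] d1.
have m2 : 2 * m <= N by rewrite NE leq_mul2r d1 orbT.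
have [S DS rotS] := fixed_core_exists n0 (A_mu_dissection AD) m0 m2 perD.
have [nu [w [_ _ muE]]] := core_word m0 NE n0 AD perD DS rotS.
exists #|S|, nu; split; last first.
  by exists S => //; rewrite inE /= fD eqxx rotS DS.
split=> //; have [c1 _ _] := proj1 (coreP S n0 (A_mu_dissection AD)) DS.
by rewrite c1 -[X in _ <= X]card_ord max_card.
Qed.

(** Modulo [d] only the invariant core remains in [mu]. *)
Lemma residual_size c c' nu nu' : 1 < d -> residual n mu d c nu -> residual n mu d c' nu' -> c = c'.
Proof.
move=> d1 [hc h] [hc' h'].
have key i : 0 < i <= n -> (c == i.+2) = (c' == i.+2).
  move=> hi; have := congr1 (modn^~ d) (etrans (esym (h i hi)) (h' i hi)) => /=.
  rewrite ![_ + d * _]addnC ![d * _]mulnC !modnMDl.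
  by rewrite !modn_small; case: (c == _); case: (c' == _) => //=; lia.
case: (ltnP 2 c) => hc2; first by have := key (c - 2); lia.
case: (ltnP 2 c') => hc2'; first by have := key (c' - 2); lia.
by lia.
Qed.

(** Forgetting the core is a bijection from [frames c] to [fixed], by existence and uniqueness of
    the invariant core; [residual_size] ensures that its size is [c]. *)
Lemma card_fixed c nu : 1 < d -> residual n mu d c nu ->
  #|fixed| * (m.-1`! * \prod_(1 <= i < n.+1) (nu i)`!) =
    (m.-1 + \sum_(1 <= i < n.+1) nu i)`!.
Proof.
move=> d1 res; rewrite -(card_frames _ res); last by right.
have [hc muE] := res; have [cE _] := residual_sum hn res; have c1 : 1 < c by lia.
congr muln; have -> : fixed = [set q.1 | q in frames c].
  apply/setP => D; apply/idP/imsetP => [fD|[[D' S]]]; last by rewrite inE => /andP [h _] ->.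
  have [c' [nu' [res' [S fS _]]]] := fixed_residual fD d1.
  by exists (D, S); rewrite ?(residual_size d1 res res').
rewrite card_in_imset // => [[D S] [D' S']] fS fS' /= E; subst D'; congr pair.
have hm : 0 < m < N by rewrite m0 NE -{1}[m]mul1n ltn_mul2r m0 d1.
have fr q : q \in frames c -> framed m c mu q.
  by rewrite inE => /and4P [/fixedP [h1 h2] /eqP h3 h4 h5].
have [w gw [E1 E2]] := framed_frame_of m0 NE muE n0 (fr _ fS).
have uniq_core T : (D, T) \in frames c -> T = outer n (arcW (repeat_word w)).
  case/fr => _ _ _ /rot_invP rT; rewrite /= -E1 => DT.
  apply: (fixed_core_unique (repeatN NE gw) (repeat_pos m0 gw) c1
    (repeat_height m0 NE c1 cE (or_intror d1) gw) (repeat_bound m0 NE c1 cE (or_intror d1) gw) hm (repeat_shift gw) rT DT).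
by rewrite (uniq_core _ fS) (uniq_core _ fS').
Qed.

(** Marking a face of a size that occurs multiplies the count by [mu i], the same factor by which
    the factorials of [remove mu i] and of [mu] differ. *)
Lemma card_fixed_all : d = 1 ->
  #|fixed| * (n.+1`! * \prod_(1 <= i < n.+1) (mu i)`!) = (n + \sum_(1 <= i < n.+1) mu i)`!.
Proof.
move=> d1; have mE : m = N by rewrite NE d1 mul1n.
have [i hi mui] : exists2 i, 0 < i <= n & 0 < mu i.
  have /hasP [i hi h] : has (fun i => 0 < mu i) (index_iota 1 n.+1).
    apply: contraTT n0 => /hasPn h; rewrite hn big_seq big1 // => i /h.
    by rewrite -eqn0Ngt => /eqP ->; rewrite muln0.
  by exists i => //; move: hi; rewrite mem_index_iota.
have res : residual n mu d i.+2 (remove mu i).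
  split=> [|k hk]; first by lia.
  by rewrite d1 mul1n /remove !eqSS [i == k]eq_sym; case: eqP => [->|]; lia.
have i3 : 2 < i.+2 by lia.
have := card_frames (or_introl i3) res.
rewrite mE /= addSnnS -sum_remove // (prod_remove hi mui) => <-.
suff -> : #|frames i.+2| = #|fixed| * mu i by ring.
rewrite -sum1_card (eq_bigl (fun q => (q.1 \in fixed) && (q.2 \in [set S in subgons q.1 | #|S| == i.+2]))).
  rewrite -(pair_big_dep (mem fixed) (fun D S => S \in [set S in subgons D | #|S| == i.+2])
    (fun _ _ => 1)) /=.
  rewrite -sum_nat_const; apply: eq_bigr => D /fixedP [].
  rewrite inE => /andP [_ /forallP h] _; rewrite sum1_card.
  have hi' : i < n.+1 by lia.
  have i0 : 0 < i by lia.
  by have /implyP /(_ i0) /eqP := h (Ordinal hi').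
move=> [D S]; rewrite !inE /= -andbA; apply/idP/idP.
  case/and5P => AD fD cS _ /orP [SD|gS]; last by rewrite AD fD gS cS.
  have /is_diagonalP [a [b [_ E]]] := dissection_diag (proj1 (andP AD)) SD.
  by move: cS; rewrite E cards2; case: (vtx n a == vtx n b) => /=; lia.
case/andP => /andP [AD fD] /andP [gS cS]; rewrite AD fD cS gS orbT andbT /=.
by apply/rot_invP => z; rewrite mE vtxDN.
Qed.
End Count.

(** The correspondence with cores needs [0 < n]; see [coreP]. *)
Lemma fixed_digon (mu : nat -> nat) j : fixed 0 mu j = [set set0].
Proof.
apply/setP => D; rewrite !inE; apply/idP/eqP => [/andP [/andP [dD _] _]|->].
  apply/setP => e; rewrite inE; apply/negP => /(dissection_diag dD)/is_diagonalP [a [b [h _]]].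
  by lia.
have -> : iter j (@rot_dissection 2) set0 = set0.
  by elim: j => //= j ->; rewrite /rot_dissection imset0.
rewrite eqxx andbT; apply/andP; split; last by apply/forallP => i; rewrite ord1.
by apply: dissection_intro => [e|a c b d _ _]; rewrite /dl inE.
Qed.

Local Open Scope ring_scope.

Lemma ev1_qfact a : ev 1 (qfact a) = a`!%:R.
Proof.
elim: a => [|a IH]; first by rewrite qfact0 ev1.
rewrite qfactS evM IH ev_qint factS natrM mulrC; congr (_ * _).
by rewrite (eq_bigr (fun _ => 1)) ?sumr_const ?card_ord // => i _; rewrite expr1n.
Qed.

Lemma eq_natr_of_mul (R : numDomainType) (z : R) (u v w : nat) : (0 < u)%N ->
  z * u%:R = w%:R -> (v * u)%N = w -> z = v%:R.
Proof.
move=> u0 E Ev; apply: (@mulIf _ u%:R); first by rewrite pnatr_eq0 -lt0n.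
by rewrite E -Ev natrM.
Qed.

Lemma prod_fact_gt0 n (f : nat -> nat) : (0 < \prod_(1 <= i < n.+1) (f i)`!)%N.
Proof. by apply: prodn_gt0 => i; exact: fact_gt0. Qed.

Theorem theorem2p3 (n : nat) (mu : nat -> nat)
  (hn : n = (\sum_(1 <= i < n.+1) i * mu i)%N) :
  let k := (\sum_(1 <= i < n.+1) mu i)%N in
  (* a_mu(q) = [n+k]_q! / ([n+1]_q [n]_q! prod_i [mu_i]_q!)
             = 1/[n+1]_q * [n+k choose k]_q * [k choose mu_1..mu_n]_q,
     required to be a polynomial in Z[q] *)
  exists a_mu : {poly int},
    a_mu * (qint n.+1 * qfact n * \prod_(1 <= i < n.+1) qfact (mu i))
      = qfact (n + k) /\
    forall zeta : algC, (n.+2).-primitive_root zeta ->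
    forall j : nat,
      (map_poly (fun x : int => x%:~R) a_mu).[zeta ^+ j]
        = (#|[set D in A_mu n mu | iter j (@rot_dissection n.+2) D == D]|)%:R.
Proof.
move=> k; have [a aE] := a_mu_exists hn; exists a; split=> // zeta hz j.
rewrite -/(ev (zeta ^+ j) a) -/(fixed n mu j).
have px := exp_prim_root hz j; set d := (n.+2 %/ _)%N in px.
have NE : n.+2 = (d * gcdn j n.+2)%N by rewrite /d divnK // dvdn_gcdr.
set x := zeta ^+ j in px *.
have [n0|n0] := posnP n.
  subst n; rewrite fixed_digon cards1; move: aE; rewrite /k !big_geq // !qfact0 !mulr1.
  by rewrite /qint big_ord1 expr0 mulr1 => ->; rewrite ev1.
have [d1|d1] : (d = 1 \/ 1 < d)%N by have := prim_order_gt0 px; lia.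
  have x1 : x = 1 by rewrite -[x]expr1 -d1 (prim_expr_order px).
  apply: eq_natr_of_mul (card_fixed_all n0 hn d1).
    by rewrite muln_gt0 fact_gt0 prod_fact_gt0.
  rewrite x1 -[RHS]ev1_qfact -aE !evM ev_prod [ev 1 (qint _) * _]mulrC -evM -qfactS ev1_qfact.
  by rewrite natrM natr_prod (eq_bigr _ (fun i _ => ev1_qfact (mu i))).
have eval c nu : residual n mu d c nu -> ev x a = #|fixed n mu j|%:R.
  move=> res; apply: eq_natr_of_mul (card_fixed n0 hn d1 res).
    by rewrite muln_gt0 fact_gt0 prod_fact_gt0.
  exact: (a_mu_eval hn aE px NE d1 res).
(* A non-zero value or a fixed dissection each yields a residual type, to which [eval] applies;
   failing both, the two sides are zero. *)
case: (eqVneq (ev x a) 0) => [a0|/(a_mu_eval_neq0 hn aE px NE d1) [c [nu /eval //]]].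
case: (set_0Vmem (fixed n mu j)) => [->|[D fD]]; first by rewrite cards0.
by have [c [nu [/eval ]]] := fixed_residual n0 fD d1.
Qed.
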